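(* Let $(X,\mu)$ be a standard atomless probability space. For any ergodic $T\in\mathrm{Aut}(X,[\mu])$, the topological derived subgroup $\overline{D([T]_{\mathrm{com}})}$ of the commensurating full group of $T$ is topologically simple.
   Context: $\mathrm{Aut}(X,[\mu])$ is the group of measurable bijections $T:X\to X$ such that $T_*\mu$ and $\mu$ have the same null sets, two such maps being identified if they agree almost everywhere. $T$ is ergodic if every $T$-invariant Borel set is null or conull; $T$ is aperiodic if almost every $T$-orbit is infinite (ergodic transformations are aperiodic since $\mu$ is atomless). Let $T\in\mathrm{Aut}(X,[\mu])$ be aperiodic. The full group $[T]$ is the group of $S\in\mathrm{Aut}(X,[\mu])$ such that for a.e. $x$, $S(x)=T^{c_S(x)}(x)$ for some integer $c_S(x)$; the a.e. uniquely defined measurable map $c_S:X\to\mathbb Z$ is the cocycle of $S$. Let $\mathrm{Sym}(\mathbb Z,\mathbb N)$ be the group of permutations $\sigma$ of $\mathbb Z$ with $|\sigma(\mathbb N)\triangle\mathbb N|<\infty$, with the group topology for which a basis of neighborhoods of the identity is given by the pointwise stabilizers of finite subsets of $\mathrm{Comm}(\mathbb N)=\{M\subset\mathbb Z: |M\triangle\mathbb N|<\infty\}$. For $S\in[T]$, $x\in X$, define the permutation $\Phi(S)(x)$ of $\mathbb Z$ by $\Phi(S)(x)(n)=n+c_S(T^n(x))$. The commensurating full group is $$[T]_{\mathrm{com}}=\{S\in[T]:\ \Phi(S)(x)\in\mathrm{Sym}(\mathbb Z,\mathbb N)\text{ for a.e. }x\},$$ endowed with the topology pulled back by $\Phi$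 from $\mathrm L^0(X,\mu,\mathrm{Sym}(\mathbb Z,\mathbb N))$, the group (under pointwise multiplication) of measurable maps $X\to\mathrm{Sym}(\mathbb Z,\mathbb N)$ modulo a.e. equality, with the topology of convergence in measure. $\overline{D([T]_{\mathrm{com}})}$ is the closure in $[T]_{\mathrm{com}}$ of the derived (commutator) subgroup of $[T]_{\mathrm{com}}$, with the induced topology. A topological group is topologically simple if it has no non-trivial closed normal subgroups, i.e. its only closed normal subgroups are the trivial group and itself. *)

(* Defs.v *)
From HB Require Import structures.
From mathcomp Require Import all_boot all_order all_algebra.
From mathcomp Require Import all_classical all_reals all_analysis.

Set Implicit Arguments.
Unset Strict Implicit.
Unset Printing Implicit Defensive.

Import Order.TTheory GRing.Theory Num.Theory.

Local Open Scope classical_set_scope.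
Local Open Scope ring_scope.

(** * Groups with a topology *)

(* Join of the two structures, with no compatibility condition. *)
#[short(type="preTopGroupType")]
HB.structure Definition PreTopGroup := {G of Group G & Topological G}.

HB.mixin Record PreTopGroup_isTopGroup G & PreTopGroup G := {
  mulg_continuous : continuous (fun x : G * G => (x.1 * x.2)%g) ;
  invg_continuous : continuous (fun x : G => (x^-1)%g)
}.

#[short(type="topGroupType")]
HB.structure Definition TopGroup :=
  {G of Pointed G & PreTopGroup G & PreTopGroup_isTopGroup G}.

Section subgroups.
Variable G : groupType.
Implicit Types H N A : set G.

Definition is_subgroup H := H 1%g /\ forall x y, H x -> H y -> H (x / y)%g.

Definition derived_subgroup H : set G :=
  smallest is_subgroup [set [~ x, y]%g | x in H & y in H].

Definition normal_subgroup H N :=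
  [/\ is_subgroup N, N `<=` H & forall x y, N x -> H y -> N (x ^ y)%g].

End subgroups.

(* A subset [H] of the ambient type carries the induced topology: its closed *)
(* subsets are the [H `&` C] with [C] closed.                                *)
Definition topologically_simple (G : preTopGroupType) (H : set G) :=
  forall N : set G, normal_subgroup H N ->
    (exists2 C : set G, closed C & N = H `&` C) -> N = [set 1%g] \/ N = H.

(** * Standard atomless probability spaces *)

(* X is Borel isomorphic to a Polish space. *)
Definition standard_borel (R : realType) d (X : measurableType d) :=
  exists (P : completePseudoMetricType R) (f : X -> P),
    [/\ hausdorff_space P, @second_countable P, bijective f &
        forall A : set P, <<s open >> A <-> measurable (f @^-1` A)].

Definition atom d (X : measurableType d) (R : realType)
    (mu : set X -> \bar R) (A : set X) :=
  [/\ measurable A, (0 < mu A)%E &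
      forall B, measurable B -> B `<=` A -> mu B = 0%E \/ mu B = mu A].

Definition atomless d (X : measurableType d) (R : realType)
    (mu : set X -> \bar R) := forall A, ~ atom mu A.

(** * The group of nonsingular transformations *)

(* Measurability of the inverse is automatic when X is standard. *)
Record nonsingular_map d (X : measurableType d) (R : realType)
    (mu : {measure set X -> \bar R}) := NonsingularMap {
  ns_fun :> X -> X ;
  ns_inv : X -> X ;
  ns_funK : cancel ns_fun ns_inv ;
  ns_invK : cancel ns_inv ns_fun ;
  measurable_ns_fun : measurable_fun [set: X] ns_fun ;
  measurable_ns_inv : measurable_fun [set: X] ns_inv ;
  ns_null : forall A, measurable A -> pushforward mu ns_fun A = 0%E <-> mu A = 0%E
}.

Section nonsingular_maps.
Context d (X : measurableType d) (R : realType).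
Variable mu : {measure set X -> \bar R}.
Local Notation nsmap := (nonsingular_map mu).
Implicit Types f g h : nsmap.

HB.instance Definition _ := gen_eqMixin nsmap.
HB.instance Definition _ := gen_choiceMixin nsmap.

Lemma measurable_preimage_ns f A : measurable A -> measurable (f @^-1` A).
Proof. by move=> mA; rewrite -[X in measurable X]setTI; exact: measurable_ns_fun. Qed.

Lemma measurable_preimage_ns_inv f A :
  measurable A -> measurable (ns_inv f @^-1` A).
Proof. by move=> mA; rewrite -[X in measurable X]setTI; exact: measurable_ns_inv. Qed.

Lemma ns_inv_null f A : measurable A ->
  pushforward mu (ns_inv f) A = 0%E <-> mu A = 0%E.
Proof.
move=> mA; have fA : f @^-1` (ns_inv f @^-1` A) = A.
  by apply/seteqP; split => x /=; rewrite ns_funK.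
rewrite -{2}fA; apply: iff_sym; apply: (ns_null f); exact: measurable_preimage_ns_inv.
Qed.

Lemma ns_mul_null f g A : measurable A ->
  pushforward mu (f \o g) A = 0%E <-> mu A = 0%E.
Proof.
move=> mA; rewrite -(ns_null f mA).
by apply: (ns_null g); exact: measurable_preimage_ns.
Qed.

Definition ns_one : nsmap :=
  @NonsingularMap _ _ _ mu idfun idfun (fun=> erefl) (fun=> erefl)
    (@measurable_id _ _ _) (@measurable_id _ _ _) (fun A _ => iff_refl _).

Definition ns_invm f : nsmap :=
  NonsingularMap (@ns_invK _ _ _ _ f) (@ns_funK _ _ _ _ f)
    (measurable_ns_inv f) (measurable_ns_fun f) (@ns_inv_null f).

Definition ns_mul f g : nsmap :=
  NonsingularMap
    (can_comp (@ns_funK _ _ _ _ f) (@ns_funK _ _ _ _ g))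
    (can_comp (@ns_invK _ _ _ _ g) (@ns_invK _ _ _ _ f))
    (measurableT_comp (measurable_ns_fun f) (measurable_ns_fun g))
    (measurableT_comp (measurable_ns_inv g) (measurable_ns_inv f))
    (@ns_mul_null f g).

Definition ns_eq f g := `[< {ae mu, forall x, f x = g x} >].

Lemma ns_eqP f g : reflect {ae mu, forall x, f x = g x} (ns_eq f g).
Proof. exact: asboolP. Qed.

Lemma ns_eq_refl : reflexive ns_eq.
Proof. by move=> f; apply/ns_eqP; exact: aeW. Qed.

Lemma ns_eq_sym : symmetric ns_eq.
Proof.
move=> f g; apply/idP/idP => /ns_eqP fg; apply/ns_eqP; apply: filterS fg => x;
  by [].
Qed.

Lemma ns_eq_trans : transitive ns_eq.
Proof.
move=> g f h /ns_eqP fg /ns_eqP gh; apply/ns_eqP.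
by apply: filterS2 fg gh => x -> ->.
Qed.

Canonical ns_eq_canonical := EquivRel ns_eq ns_eq_refl ns_eq_sym ns_eq_trans.

Lemma ae_preimage_ns f (P : X -> Prop) :
  {ae mu, forall x, P x} -> {ae mu, forall x, P (f x)}.
Proof.
move=> [N [mN N0 PN]]; exists (f @^-1` N); split.
- exact: measurable_preimage_ns.
- exact/(ns_null f).
- by move=> x /= Px; apply: PN.
Qed.

Lemma ns_eq_mul f f' g g' :
  ns_eq f f' -> ns_eq g g' -> ns_eq (ns_mul f g) (ns_mul f' g').
Proof.
move=> /ns_eqP ff' /ns_eqP gg'; apply/ns_eqP.
by apply: filterS2 (ae_preimage_ns g ff') gg' => x /= -> ->.
Qed.

Lemma ns_eq_inv f g : ns_eq f g -> ns_eq (ns_invm f) (ns_invm g).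
Proof.
move=> /ns_eqP fg; apply/ns_eqP.
apply: filterS (ae_preimage_ns (ns_invm f) fg) => x /=.
by rewrite ns_invK => {2}->; rewrite ns_funK.
Qed.

Local Open Scope quotient_scope.

Definition aut : Type := {eq_quot ns_eq}.
HB.instance Definition _ := Choice.on aut.
HB.instance Definition _ := EqQuotient.on aut.

Definition aut_class (f : nsmap) : aut := \pi_aut f.
Definition aut_map (S : aut) : nsmap := repr S.

Definition aut_one : aut := aut_class ns_one.
Definition aut_inv (S : aut) : aut := aut_class (ns_invm (aut_map S)).
Definition aut_mul (S T : aut) : aut :=
  aut_class (ns_mul (aut_map S) (aut_map T)).

Lemma aut_classP f g : aut_class f = aut_class g <-> ns_eq f g.
Proof. by split => [/eqmodP|fg]; last exact/eqmodP. Qed.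

Lemma aut_mapK (S : aut) : aut_class (aut_map S) = S.
Proof. exact: reprK. Qed.

Lemma aut_class_mul f g :
  aut_class (ns_mul f g) = aut_mul (aut_class f) (aut_class g).
Proof.
by apply/aut_classP/ns_eq_mul; apply/aut_classP; rewrite aut_mapK.
Qed.

Lemma aut_class_inv f : aut_class (ns_invm f) = aut_inv (aut_class f).
Proof. by apply/aut_classP/ns_eq_inv/aut_classP; rewrite aut_mapK. Qed.

Lemma aut_class_eq f g : f =1 g -> aut_class f = aut_class g.
Proof. by move=> fg; apply/aut_classP/ns_eqP; exact: aeW. Qed.

Lemma aut_mulA : associative aut_mul.
Proof.
move=> S T U.
rewrite -(aut_mapK S) -(aut_mapK T) -(aut_mapK U) -!aut_class_mul.
exact: aut_class_eq.
Qed.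

Lemma aut_mul1 : left_id aut_one aut_mul.
Proof. by move=> S; rewrite -(aut_mapK S) -!aut_class_mul; exact: aut_class_eq. Qed.

Lemma aut_1mul : right_id aut_one aut_mul.
Proof. by move=> S; rewrite -(aut_mapK S) -!aut_class_mul; exact: aut_class_eq. Qed.

Lemma aut_mulV : left_inverse aut_one aut_inv aut_mul.
Proof.
move=> S; rewrite -(aut_mapK S) -aut_class_inv -!aut_class_mul.
by apply: aut_class_eq => x /=; rewrite ns_funK.
Qed.

Lemma aut_Vmul : right_inverse aut_one aut_inv aut_mul.
Proof.
move=> S; rewrite -(aut_mapK S) -aut_class_inv -!aut_class_mul.
by apply: aut_class_eq => x /=; rewrite ns_invK.
Qed.

HB.instance Definition _ := isGroup.Build aut
  aut_mulA aut_mul1 aut_1mul aut_mulV aut_Vmul.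

End nonsingular_maps.

(** * The group Sym(Z, N) of permutations of Z commensurating N *)

Definition natZ : set int := [set k | 0 <= k].

Definition commN : set (set int) := [set M | finite_set (M `+` natZ)].

Definition commensurating (f : int -> int) :=
  bijective f /\ commN (f @` natZ).

Record symZN := SymZN {
  sym_fun :> int -> int ;
  sym_inv : int -> int ;
  sym_funK : cancel sym_fun sym_inv ;
  sym_invK : cancel sym_inv sym_fun ;
  sym_comm : commN (sym_fun @` natZ)
}.

Section symZN_group.
Implicit Types s t u : symZN.

HB.instance Definition _ := gen_eqMixin symZN.
HB.instance Definition _ := gen_choiceMixin symZN.

Lemma symZN_eq s t : s =1 t -> s = t.
Proof.
case: s t => [f f' fK Kf cf] [g g' gK Kg cg] /= /funext fg.
move: fK Kf cf; rewrite {}fg => fK Kf cf.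
have f'g' : f' = g' by apply: funext => x; rewrite -[x in LHS]Kg fK.
move: fK Kf; rewrite {}f'g' => fK Kf.
by congr SymZN; exact: Prop_irrelevance.
Qed.

Lemma finite_setY_trans (A B C : set int) :
  finite_set (A `+` B) -> finite_set (B `+` C) -> finite_set (A `+` C).
Proof.
move=> AB BC; apply: (@sub_finite_set _ _ ((A `+` B) `|` (B `+` C))).
  move=> x /= [[Ax Cx]|[Cx Ax]]; have [Bx|Bx] := pselect (B x);
    by [left; left|left; right|right; left|right; right].
by rewrite finite_setU.
Qed.

Lemma finite_setY_image (f : int -> int) (A B : set int) : injective f ->
  finite_set (A `+` B) -> finite_set ((f @` A) `+` (f @` B)).
Proof.
move=> finj AB; apply: (@sub_finite_set _ _ (f @` (A `+` B))).
  move=> x /= [[[y Ay <-] Bx]|[[y By <-] Ax]]; exists y => //.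
    by left; split => // By; apply: Bx; exists y.
  by right; split => // Ay; apply: Ax; exists y.
exact: finite_image.
Qed.

Lemma commN_sym s M : commN M -> commN (s @` M).
Proof.
move=> cM; apply: (finite_setY_trans (B := s @` natZ)); last exact: sym_comm.
by apply: finite_setY_image => //; exact: can_inj (@sym_funK s).
Qed.

Lemma commN_one : commN (idfun @` natZ).
Proof. by rewrite /commN /= image_id /setY setDv setU0; exact: finite_set0. Qed.

Lemma sym_invE s (A : set int) : sym_inv s @` (s @` A) = A.
Proof.
rewrite image_comp (_ : _ \o _ = id) ?image_id//.
by apply: funext => x /=; rewrite sym_funK.
Qed.

Lemma sym_funE s (A : set int) : s @` (sym_inv s @` A) = A.
Proof.
rewrite image_comp (_ : _ \o _ = id) ?image_id//.
by apply: funext => x /=; rewrite sym_invK.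
Qed.

Lemma commN_inv s : commN (sym_inv s @` natZ).
Proof.
have := finite_setY_image (can_inj (@sym_invK s)) (sym_comm s).
by rewrite sym_invE /commN /setY setUC.
Qed.

Lemma commN_mul s t : commN ((s \o t) @` natZ).
Proof. by rewrite -image_comp; apply/commN_sym/sym_comm. Qed.

Definition sym_one : symZN :=
  @SymZN idfun idfun (fun=> erefl) (fun=> erefl) commN_one.

Definition sym_invm s : symZN := SymZN (@sym_invK s) (@sym_funK s) (commN_inv s).

Definition sym_mul s t : symZN :=
  SymZN (can_comp (@sym_funK s) (@sym_funK t))
    (can_comp (@sym_invK t) (@sym_invK s)) (commN_mul s t).

Lemma sym_mulA : associative sym_mul.
Proof. by move=> s t u; exact: symZN_eq. Qed.

Lemma sym_mul1 : left_id sym_one sym_mul.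
Proof. by move=> s; exact: symZN_eq. Qed.

Lemma sym_1mul : right_id sym_one sym_mul.
Proof. by move=> s; exact: symZN_eq. Qed.

Lemma sym_mulV : left_inverse sym_one sym_invm sym_mul.
Proof. by move=> s; apply: symZN_eq => x /=; rewrite sym_funK. Qed.

Lemma sym_Vmul : right_inverse sym_one sym_invm sym_mul.
Proof. by move=> s; apply: symZN_eq => x /=; rewrite sym_invK. Qed.

HB.instance Definition _ := isGroup.Build symZN
  sym_mulA sym_mul1 sym_1mul sym_mulV sym_Vmul.
HB.instance Definition _ := isPointed.Build symZN 1%g.

Lemma sym_mulE s t x : (s * t)%g x = s (t x). Proof. by []. Qed.

Lemma sym_imageM s t (A : set int) : (s * t)%g @` A = s @` (t @` A).
Proof. by rewrite image_comp. Qed.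

Lemma sym_imageV s (A B : set int) : (s^-1)%g @` A = B <-> A = s @` B.
Proof. by split => [<-|->]; rewrite ?sym_funE ?sym_invE. Qed.

Definition stabilizer (F : set (set int)) : set symZN :=
  [set s | forall M, F M -> s @` M = M].

Definition sym_nbhs (s : symZN) : set_system symZN :=
  [set A | exists F : set (set int), [/\ finite_set F, F `<=` commN &
    forall t, stabilizer F (s^-1 * t)%g -> A t]].

HB.instance Definition _ := hasNbhs.Build symZN sym_nbhs.

Lemma stabilizer_one F : stabilizer F 1%g.
Proof. by move=> M _; exact: image_id. Qed.

Lemma stabilizerM F s t : stabilizer F s -> stabilizer F t ->
  stabilizer F (s * t)%g.
Proof. by move=> Fs Ft M FM; rewrite sym_imageM Ft// Fs. Qed.

Lemma sym_nbhs_filter s : ProperFilter (nbhs s).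
Proof.
apply: Build_ProperFilter_ex.
  move=> A [F [_ _ FA]]; exists s; apply: FA.
  by rewrite mulVg; exact: stabilizer_one.
split.
- by exists set0; split.
- move=> A B [F [F0 cF FA]] [F' [F'0 cF' F'B]]; exists (F `|` F'); split.
  + by rewrite finite_setU.
  + by rewrite subUset.
  + move=> t Ft; split; [apply: FA|apply: F'B] => M FM; apply: Ft;
      by [left|right].
- move=> A B AB [F [F0 cF FA]]; exists F; split => // t /FA; exact: AB.
Qed.

Lemma sym_nbhs_singleton s (A : set symZN) : nbhs s A -> A s.
Proof.
by move=> [F [_ _ FA]]; apply: FA; rewrite mulVg; exact: stabilizer_one.
Qed.

Lemma sym_nbhs_nbhs s (A : set symZN) : nbhs s A -> nbhs s (nbhs^~ A).
Proof.
move=> [F [F0 cF FA]]; exists F; split => // t Ft; exists F; split => // u Fu.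
apply: FA; rewrite (_ : _ * _ = (s^-1 * t) * (t^-1 * u))%g.
  exact: stabilizerM.
by rewrite -mulgA mulVKg.
Qed.

HB.instance Definition _ := Nbhs_isNbhsTopological.Build symZN
  sym_nbhs_filter sym_nbhs_singleton sym_nbhs_nbhs.

Lemma sym_mulg_continuous : continuous (fun x : symZN * symZN => (x.1 * x.2)%g).
Proof.
move=> [s t] A [F [F0 cF FA]].
exists ([set s' | stabilizer [set t @` M | M in F] (s^-1 * s')%g],
        [set t' | stabilizer F (t^-1 * t')%g]) => /=.
  split; last by exists F.
  exists [set t @` M | M in F]; split => //; first exact: finite_image.
  by move=> _ [M FM <-]; exact/commN_sym/cF.
move=> [s' t'] [/= Fs Ft]; apply: FA => M FM.
have t'M : t' @` M = t @` M by apply/sym_imageV; rewrite -sym_imageM Ft.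
have s'M : s' @` (t @` M) = s @` (t @` M).
  by apply/sym_imageV; rewrite -sym_imageM Fs//; exists M.
by rewrite sym_imageM; apply/sym_imageV; rewrite !sym_imageM t'M s'M.
Qed.

Lemma sym_invg_continuous : continuous (fun x : symZN => (x^-1)%g).
Proof.
move=> s A [F [F0 cF FA]].
exists [set s^-1%g @` M | M in F]; split.
- exact: finite_image.
- by move=> _ [M FM <-]; exact/commN_sym/cF.
move=> t Ft; apply: FA => M FM; rewrite invgK.
have /sym_imageV tM : (s^-1)%g @` (t @` ((s^-1)%g @` M)) = (s^-1)%g @` M.
  by rewrite -sym_imageM; apply: Ft; exists M.
rewrite sym_imageM (_ : (t^-1)%g @` M = (s^-1)%g @` M); first exact: sym_funE.
by apply/sym_imageV; rewrite tM sym_funE.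
Qed.

HB.instance Definition _ := PreTopGroup_isTopGroup.Build symZN
  sym_mulg_continuous sym_invg_continuous.

End symZN_group.

(** * Measurable maps modulo a.e. equality, with convergence in measure *)

Section L0.
Context d (X : measurableType d) (R : realType).
Variables (mu : {measure set X -> \bar R}) (G : topGroupType).

Definition L0 : Type := {mfun_ mu, X >-> g_sigma_algebraType (@open G)}.

HB.instance Definition _ := Choice.on L0.
HB.instance Definition _ := EqQuotient.on L0.

Definition L0_fun (f : L0) : X -> G := aqEqMfun_to_fun f.

Implicit Types f g h : L0.

(* The set of x such that f(x)^-1 g(x) is not in U has outer measure < e. *)
Definition in_measure_close (U : set G) (e : R) f g :=
  exists E, [/\ measurable E, (mu E < e%:E)%E &
    forall x, ~ E x -> U ((L0_fun f x)^-1 * L0_fun g x)%g].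

Definition in_measure_nbhs f : set_system L0 :=
  [set A | exists (U : set G) (e : R), [/\ nbhs (1%g : G) U, 0 < e &
    forall g, in_measure_close U e f g -> A g]].

HB.instance Definition _ := hasNbhs.Build L0 in_measure_nbhs.

Lemma in_measure_refl U e f : nbhs (1%g : G) U -> 0 < e ->
  in_measure_close U e f f.
Proof.
move=> U1 e0; exists set0; split => //; first by rewrite measure0 lte_fin.
by move=> x _; rewrite mulVg; exact: nbhs_singleton.
Qed.

Lemma in_measureS U V e e' f g : U `<=` V -> e <= e' ->
  in_measure_close U e f g -> in_measure_close V e' f g.
Proof.
move=> UV ee' [E [mE Ee EU]]; exists E; split => //.
  by rewrite (lt_le_trans Ee)// lee_fin.
by move=> x /EU /UV.
Qed.

Lemma L0_nbhs_filter f : ProperFilter (nbhs f).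
Proof.
apply: Build_ProperFilter_ex.
  by move=> A [U [e [U1 e0 UA]]]; exists f; apply: UA; exact: in_measure_refl.
split.
- by exists setT, 1; split => //; exact: filterT.
- move=> A B [U [e [U1 e0 UA]]] [V [e' [V1 e'0 VB]]].
  exists (U `&` V), (Num.min e e'); split => //; first exact: filterI.
    by rewrite lt_min e0.
  move=> g fg; split; [apply: UA|apply: VB]; apply: in_measureS fg.
  + by move=> ? [].
  + by rewrite ge_min lexx.
  + by move=> ? [].
  + by rewrite ge_min lexx orbT.
- by move=> A B AB [U [e [U1 e0 UA]]]; exists U, e; split => // g /UA /AB.
Qed.

Lemma L0_nbhs_singleton f (A : set L0) : nbhs f A -> A f.
Proof.
by move=> [U [e [U1 e0 UA]]]; apply: UA; exact: in_measure_refl.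
Qed.

Lemma L0_nbhs_nbhs f (A : set L0) : nbhs f A -> nbhs f (nbhs^~ A).
Proof.
move=> [U [e [U1 e0 UA]]].
have : nbhs ((1%g, 1%g) : G * G) [set x | U (x.1 * x.2)%g].
  by apply: (@mulg_continuous G (1%g, 1%g)); rewrite /= mulg1.
move=> [[V W] [/= V1 W1] VWU].
exists V, (e / 2); split => //; first by rewrite divr_gt0.
move=> g [E [mE Ee EV]]; exists W, (e / 2); split => //.
  by rewrite divr_gt0.
move=> h [E' [mE' E'e E'W]]; apply: UA.
exists (E `|` E'); split; first exact: measurableU.
  rewrite (le_lt_trans (measureU2 _ _ _))//.
  by rewrite [ltRHS](_ : _ = (e / 2)%:E + (e / 2)%:E)%E ?lteD// -EFinD -splitr.
move=> x /not_orP[/EV Vx /E'W Wx].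
rewrite (_ : (_ * _)%g =
  (((L0_fun f x)^-1 * L0_fun g x) * ((L0_fun g x)^-1 * L0_fun h x))%g).
  exact: (VWU (_, _)).
by rewrite -mulgA mulVKg.
Qed.

HB.instance Definition _ := Nbhs_isNbhsTopological.Build L0
  L0_nbhs_filter L0_nbhs_singleton L0_nbhs_nbhs.

End L0.

(** * The commensurating full group *)

HB.instance Definition _ := isPointed.Build int 0.
HB.instance Definition _ := @isMeasurable.Build default_measure_display
  int discrete_measurable discrete_measurable0
  discrete_measurableC discrete_measurableU.

Section commensurating_full_group.
Context d (X : measurableType d) (R : realType).
Variable mu : {measure set X -> \bar R}.
Implicit Types S T : aut mu.

(* Ergodicity, orbits and cocycles are computed on chosen representatives; *)
(* another choice changes them on null sets only.                          *)
Definition ergodic T := forall A : set X, measurable A ->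
  aut_map T @^-1` A = A -> mu A = 0%E \/ mu (~` A) = 0%E.

Definition aut_iter T (k : int) : X -> X :=
  match k with
  | Posz n => iter n (aut_map T)
  | Negz n => iter n.+1 (ns_inv (aut_map T))
  end.

Definition full_group T : set (aut mu) :=
  [set S | {ae mu, forall x, exists k : int, aut_map S x = aut_iter T k x}].

(* For S in [full_group T] with T aperiodic and X standard, such a c exists *)
(* and is unique up to a null set; the default 0 is never used.            *)
Definition is_cocycle T S (c : X -> int) :=
  measurable_fun [set: X] c /\
  {ae mu, forall x, aut_map S x = aut_iter T (c x) x}.

Definition cocycle T S : X -> int := xget (fun=> 0) (is_cocycle T S).

Definition cocycle_perm T S (x : X) : int -> int :=
  fun n => n + cocycle T S (aut_iter T n x).

Definition com_full_group T : set (aut mu) :=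
  [set S | full_group T S /\
    {ae mu, forall x, commensurating (cocycle_perm T S x)}].

(* The default value is only used on the x for which the permutation is not *)
(* commensurating.                                                          *)
Definition Phi_fun T S (x : X) : symZN :=
  xget 1%g [set s : symZN | s =1 cocycle_perm T S x].

Lemma commensurating_ex (f : int -> int) :
  commensurating f <-> exists s : symZN, s =1 f.
Proof.
split=> [[[g fK gK] cf]|[s /funext <-]]; first by exists (SymZN fK gK cf).
by split; [exists (sym_inv s); [exact: sym_funK|exact: sym_invK]|exact: sym_comm].
Qed.

Lemma Phi_funE T S x : commensurating (cocycle_perm T S x) ->
  Phi_fun T S x =1 cocycle_perm T S x.
Proof.
move=> /commensurating_ex; exact: (@xgetPex _ _ [set s : symZN | s =1 _]).
Qed.

Lemma Phi_fun_default T S x : ~ commensurating (cocycle_perm T S x) ->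
  Phi_fun T S x = 1%g.
Proof.
by move=> /commensurating_ex sf; apply: xgetPN => s ss; apply: sf; exists s.
Qed.

Lemma measurable_aut_iter T k : measurable_fun [set: X] (aut_iter T k).
Proof.
have mi (f : X -> X) n : measurable_fun [set: X] f ->
    measurable_fun [set: X] (iter n f).
  move=> mf; elim: n => [|n IH]; first exact: measurable_id.
  exact: (measurableT_comp mf IH).
by case: k => n; apply: mi; [exact: measurable_ns_fun|exact: measurable_ns_inv].
Qed.

Lemma measurable_cocycle T S : measurable_fun [set: X] (cocycle T S).
Proof.
rewrite /cocycle; case: xgetP => [c _ []//|_]; exact: measurable_cst.
Qed.

Let ms (P : X -> Prop) := measurable [set x | P x].

Let ms_cst (P : Prop) : ms (fun=> P).
Proof.
have [p|p] := pselect P.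
  by rewrite /ms (_ : [set _ | _] = setT)//; apply/seteqP; split.
by rewrite /ms (_ : [set _ | _] = set0)//; apply/seteqP; split.
Qed.

Let ms_not P : ms P -> ms (fun x => ~ P x).
Proof. exact: measurableC. Qed.

Let ms_and P Q : ms P -> ms Q -> ms (fun x => P x /\ Q x).
Proof. exact: measurableI. Qed.

Let ms_ext P Q : (forall x, P x <-> Q x) -> ms P -> ms Q.
Proof. by move=> PQ; rewrite (_ : P = Q)//; apply/funext => x; apply/propext. Qed.

Let ms_or P Q : ms P -> ms Q -> ms (fun x => P x \/ Q x).
Proof. exact: measurableU. Qed.

Let ms_imp P Q : ms P -> ms Q -> ms (fun x => P x -> Q x).
Proof.
move=> mP mQ; apply: (ms_ext _ (ms_or (ms_not mP) mQ)) => x.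
by split=> [[]//|PQ]; have [/PQ|] := pselect (P x); [right|left].
Qed.

Let ms_iff P Q : ms P -> ms Q -> ms (fun x => P x <-> Q x).
Proof. by move=> mP mQ; apply: ms_and; exact: ms_imp. Qed.

Let ms_ex (I : countType) (P : I -> X -> Prop) :
  (forall i, ms (P i)) -> ms (fun x => exists i, P i x).
Proof.
move=> mP; rewrite /ms (_ : [set _ | _] = \bigcup_i [set x | P i x]).
  by apply: countable_bigcupT_measurable; [exact: countableP|exact: mP].
by apply/seteqP; split => x [i]; exists i.
Qed.

Let ms_all (I : countType) (P : I -> X -> Prop) :
  (forall i, ms (P i)) -> ms (fun x => forall i, P i x).
Proof.
move=> mP.
have /ms_not : ms (fun x => exists i, ~ P i x).
  by apply: ms_ex => i; exact: ms_not.
by apply: ms_ext => x; rewrite -forallNP; split => h i; [exact: contrapT|].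
Qed.

Let code (a : seq int) : set int := natZ `+` [set` a].

Let codeP M : commN M -> exists a, M = code a.
Proof.
move=> /finite_seqP[a Ma]; exists a; rewrite /code -Ma; apply/seteqP.
by split=> x; move: (EM (M x)) (EM (natZ x)) => /=; tauto.
Qed.

Let code_comm a : commN (code a).
Proof.
apply: (@sub_finite_set _ _ [set` a]); last exact: finite_seq.
by rewrite /code => x; move: (EM (natZ x)) (EM (x \in a)) => /=; tauto.
Qed.

Let ms_perm T S n m : ms (fun x => cocycle_perm T S x n = m).
Proof.
apply: (@ms_ext (fun x => (cocycle T S \o aut_iter T n) x \in [set m - n])).
  move=> x; rewrite inE /cocycle_perm /=; split=> [->|<-]; first by rewrite addrC subrK.
  by rewrite addrAC subrr add0r.
have := measurableT_comp (measurable_cocycle T S) (measurable_aut_iter T n).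
move=> /(_ measurableT [set m - n] I); rewrite setTI.
by apply: ms_ext => x; rewrite inE.
Qed.

Let ms_commensurating T S : ms (fun x => commensurating (cocycle_perm T S x)).
Proof.
pose f := cocycle_perm T S.
apply: (@ms_ext (fun x => (forall m, exists n, f x n = m) /\
    (forall n n' m, f x n = m -> f x n' = m -> n = n') /\
    exists a, forall m, (exists n, natZ n /\ f x n = m) <-> code a m)).
  move=> x; split.
    move=> [fs [fi [a fa]]]; split.
      rewrite -setTT_bijective; split => //.
      + by move=> n n' _ _ /esym; exact: fi.
      + by move=> m _; have [n <-] := fs m; exists n.
    rewrite (_ : f x @` natZ = code a); first exact: code_comm.
    by apply/seteqP; split => m; [move=> [n nn <-]; apply/fa; exists n|
      move=> /fa[n [nn <-]]; exists n].
  move=> [[g fK gK] /codeP[a fa]]; split; last split.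
  + by move=> m; exists (g m); exact: gK.
  + by move=> n n' m <- /(can_inj fK).
  + exists a => m; rewrite -fa; split=> [[n [nn <-]]|[n nn <-]]; exists n => //.
apply: ms_and.
  by apply: ms_all => m; apply: ms_ex => n; exact: ms_perm.
apply: ms_and.
  apply: ms_all => n; apply: ms_all => n'; apply: ms_all => m.
  apply: ms_imp; first exact: ms_perm.
  by apply: ms_imp; [exact: ms_perm|exact: ms_cst].
apply: ms_ex => a; apply: ms_all => m; apply: ms_iff; last exact: ms_cst.
by apply: ms_ex => n; apply: ms_and; [exact: ms_cst|exact: ms_perm].
Qed.

Let ms_Phi T S n m : ms (fun x => Phi_fun T S x n = m).
Proof.
pose C x := commensurating (cocycle_perm T S x).
apply: (@ms_ext (fun x => (C x -> cocycle_perm T S x n = m) /\ (~ C x -> n = m))).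
  move=> x; have [Cx|Cx] := pselect (C x).
    by rewrite (Phi_funE Cx); tauto.
  by rewrite (Phi_fun_default Cx)/=; tauto.
apply: ms_and; apply: ms_imp.
- exact: ms_commensurating.
- exact: ms_perm.
- exact/ms_not/ms_commensurating.
- exact: ms_cst.
Qed.

Lemma measurable_Phi_fun T S : measurable_fun [set: X]
  (Phi_fun T S : X -> g_sigma_algebraType (@open symZN)).
Proof.
apply: (@measurability _ _ X (g_sigma_algebraType (@open symZN)) setT
  (Phi_fun T S) (@open symZN)) => // _ [V oV <-].
rewrite setTI.
pose B (i : seq (seq int * seq int)) : set symZN :=
  [set s | forall p, p \in i -> s @` code p.1 = code p.2].
apply: (@ms_ext (fun x => exists i, (B i `<=` V) /\ B i (Phi_fun T S x))).
  move=> x; split=> [[i [BV Bi]]|]; first exact: BV.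
  set s := Phi_fun T S x => Vs.
  have : nbhs s V by exact: open_nbhs_nbhs.
  move=> [F [/finite_seqP[l Fl] cF FV]].
  have [i [Bis Bi]] : exists i : seq (seq int * seq int), B i s /\
      forall t M, B i t -> M \in l -> t @` M = s @` M.
    have : forall M, M \in l -> commN M by move=> M Ml; apply: cF; rewrite Fl.
    elim: l {Fl} => [|M l IH] cl.
      by exists [::]; split.
    have [|i [Bi Hi]] := IH; first by move=> N Nl; apply: cl; rewrite inE Nl orbT.
    have cM : commN M by apply: cl; rewrite inE eqxx.
    have [a Ma] := codeP cM.
    have [b Mb] := codeP (commN_sym s cM).
    exists ((a, b) :: i); split.
      by move=> p; rewrite inE => /predU1P[->/=|/Bi//]; rewrite -Ma.
    move=> t N Bt; rewrite inE => /predU1P[->|Nl].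
      by rewrite Mb Ma; apply: (Bt (a, b)); rewrite inE eqxx.
    by apply: Hi => // p pi; apply: Bt; rewrite inE pi orbT.
  exists i; split => // t Bt; apply: FV => M; rewrite Fl => Ml.
  by rewrite sym_imageM; apply/sym_imageV; exact: Bi.
apply: ms_ex => i; apply: ms_and; first exact: ms_cst.
apply: ms_all => p; apply: ms_imp; first exact: ms_cst.
apply: (@ms_ext (fun x => forall n m, Phi_fun T S x n = m ->
    (code p.1 n <-> code p.2 m))).
  move=> x; set s := Phi_fun T S x; split=> [h|<- n m <-].
    apply/seteqP; split => m; first by move=> [n nn <-]; apply/(h n).
    by move=> pm; exists (sym_inv s m); rewrite ?sym_invK// (h _ m)// sym_invK.
  split=> [pn|[n' pn' /(can_inj (@sym_funK s)) <-]]; [by exists n|by []].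
by apply: ms_all => n; apply: ms_all => m; apply: ms_imp;
  [exact: ms_Phi|exact: ms_cst].
Qed.

HB.instance Definition _ T S := isMeasurableFun.Build _ _ _ _
  (Phi_fun T S : X -> g_sigma_algebraType (@open symZN))
  (measurable_Phi_fun T S).

Local Open Scope quotient_scope.

Definition Phi T S : L0 mu symZN :=
  \pi_(L0 mu symZN)
    (Phi_fun T S : {mfun X >-> g_sigma_algebraType (@open symZN)}).

Lemma Phi_ae T S : com_full_group T S ->
  {ae mu, forall x, L0_fun (Phi T S) x =1 cocycle_perm T S x}.
Proof.
move=> [_ cS].
have : Phi T S = Phi T S by [].
rewrite -{1}[Phi T S]reprK => /eqmodP/asboolP/= Phi_repr.
apply: filterS2 cS Phi_repr => x cSx Phix.
by move=> n; rewrite -(Phi_funE cSx) /L0_fun /aqEqMfun_to_fun Phix.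
Qed.

(* [aut mu] with the topology pulled back by [Phi T]; this is only meaningful *)
(* on the subset [com_full_group T].                                          *)
Definition aut_com T : Type := initial_topology (Phi T).

HB.instance Definition _ T := Group.on (aut_com T).
HB.instance Definition _ T := Topological.copy (aut_com T) (initial_topology (Phi T)).

Definition com_top_derived T : set (aut_com T) :=
  com_full_group T `&`
  closure (derived_subgroup (com_full_group T) : set (aut_com T)).

End commensurating_full_group.

Arguments com_top_derived {d X R mu} T _.

(* Main.v *)
Require Import Defs.
From mathcomp Require Import all_boot all_order all_algebra fingroup perm gseries alt.
From mathcomp Require Import all_classical all_reals all_analysis.
From mathcomp Require Import zify.

Set Implicit Arguments.
Unset Strict Implicit.
Unset Printing Implicit Defensive.

Import Order.TTheory GRing.Theory Num.Theory.

Local Open Scope classical_set_scope.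
Local Open Scope ring_scope.

(** The proof follows the classical scheme for the simplicity of full groups:
    a nontrivial normal subgroup N contains small alternating groups, and these
    topologically generate everything. Here G is the commensurating full group,
    H the closure of its derived subgroup, and t the action of the powers of T;
    the orbits of t are almost surely free copies of the integers.

    Let N be a nontrivial normal subgroup of H, relatively closed. It is enough to
    see that N contains every commutator of G.

    - Local step ([local_tower_perm]). If B has finitely many pairwise disjoint
      translates, the permutations of these translates form a copy of a symmetric
      group inside G, whose alternating subgroup lies in D(G). An element g of N
      displaces some set A of positive measure, and by recurrence a piece of B has
      further translates inside A. For h and k supported in A, the commutator
      [h, k] can be written with g and thus lies in N ([commutator_trick]). As
      alternating groups on at least 5 letters are simple, N contains all even
      permutations of the translates of that piece, and an arbitrary permutation
      becomes even after being repeated on two translates of the piece.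

    - Exhaustion ([restriction_limit], [exhaustion]). In G, the restrictions of an
      element S to invariant sets increasing to X converge to S, since for almost
      every x only finitely many points of the orbit cross x under S. Hence S is
      in N as soon as S can be restricted, below any invariant set of positive
      measure, to an element of N.

    - Periodic elements ([periodic_in_normal]). If almost all orbits of S in G are
      finite, then S is locally a cyclic permutation of the levels of a tower, so
      the first two steps put S in N.

    - Index ([ex_preserved_cut], [index_zero_in_normal]). The index of a permutation
      of the integers that commensurates the half-line of nonnegative integers,
      namely the number of entries into the half-line minus the number of exits, is
      additive; it vanishes on commutators. If w in G
      has index zero almost surely, choose a sparse set A of positive measure around
      the points of which the crossings made by w follow one finite pattern. Index
      zero allows a permutation p of a window around A, constant over A, to undo
      these crossings. Then both p and p w are periodic: p w preserves the finite
      intervals between consecutive visits to A. So w is in N. *)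

Section subgroups.
Variables (G : groupType) (N : set G).
Hypothesis N_sub : is_subgroup N.

Lemma subgroup1 : N 1%g. Proof. by case: N_sub. Qed.

Lemma subgroupV x : N x -> N x^-1%g.
Proof. by case: N_sub => N1 Nd Nx; rewrite -[x^-1%g]mul1g; exact: Nd. Qed.

Lemma subgroupM x y : N x -> N y -> N (x * y)%g.
Proof.
by case: N_sub => N1 Nd Nx /subgroupV Ny; rewrite -[y]invgK; exact: Nd.
Qed.

End subgroups.

(** * Measurable sets and almost everywhere statements *)

Section measurable_sets.
Context d (X : measurableType d).

Lemma measurable_existsc (I : countType) (P : I -> X -> Prop) :
  (forall i, measurable [set x | P i x]) -> measurable [set x | exists i, P i x].
Proof.
move=> mP; rewrite (_ : [set _ | _] = \bigcup_i [set x | P i x]).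
  by apply: countable_bigcupT_measurable; [exact: countableP|exact: mP].
by apply/seteqP; split => x [i]; exists i.
Qed.

Lemma measurable_forallc (I : countType) (P : I -> X -> Prop) :
  (forall i, measurable [set x | P i x]) -> measurable [set x | forall i, P i x].
Proof.
move=> mP; rewrite (_ : [set _ | _] = ~` [set x | exists i, ~ P i x]).
  by apply/measurableC/measurable_existsc => i; exact: measurableC (mP i).
apply/seteqP; split => x /=; first by move=> Px [i]; exact.
by move=> nP i; apply: contrapT => Pi; apply: nP; exists i.
Qed.

Lemma measurable_cstP (P : Prop) : measurable [set x : X | P].
Proof.
have [p|p] := pselect P.
  by rewrite (_ : [set _ | _] = setT)//; apply/seteqP; split.
by rewrite (_ : [set _ | _] = set0)//; apply/seteqP; split.
Qed.

Lemma measurable_andP (P Q : X -> Prop) : measurable [set x | P x] ->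
  measurable [set x | Q x] -> measurable [set x | P x /\ Q x].
Proof. exact: measurableI. Qed.

Lemma measurable_imply (P Q : X -> Prop) : measurable [set x | P x] ->
  measurable [set x | Q x] -> measurable [set x | P x -> Q x].
Proof.
move=> mP mQ; rewrite (_ : [set _ | _] = ~` [set x | P x] `|` [set x | Q x]).
  by apply: measurableU => //; exact: measurableC.
apply/seteqP; split => x /=; last by case.
by move=> PQ; have [/PQ|] := pselect (P x); [right|left].
Qed.

Lemma measurable_ifP (P Q : X -> Prop) : measurable [set x | P x] ->
  measurable [set x | Q x] -> measurable [set x | P x <-> Q x].
Proof. by move=> mP mQ; apply: measurable_andP; exact: measurable_imply. Qed.

End measurable_sets.

Section almost_everywhere.
Context (R : realType) d (X : measurableType d) (mu : {measure set X -> \bar R}).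
Implicit Types A B : set X.

Lemma ae_forallc (I : countType) (P : I -> X -> Prop) :
  (forall i, {ae mu, forall x, P i x}) -> {ae mu, forall x, forall i, P i x}.
Proof.
move=> aeP.
have : {ae mu, forall x, forall n : nat, forall i, unpickle n = Some i -> P i x}.
  apply: ae_foralln => n; case E : (unpickle n) => [i|]; last exact: aeW.
  by apply: filterS (aeP i) => x Px j [<-].
by apply: filterS => x Px i; apply: (Px (pickle i)); exact: pickleK.
Qed.

Lemma ae_andP (P Q : X -> Prop) : {ae mu, forall x, P x} ->
  {ae mu, forall x, Q x} -> {ae mu, forall x, P x /\ Q x}.
Proof. by move=> aeP aeQ; apply: filterS2 aeP aeQ => x Px Qx; split. Qed.

Lemma ae_not A : measurable A -> {ae mu, forall x, ~ A x} <-> mu A = 0%E.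
Proof.
move=> mA; rewrite -(negligibleP _ mA) /prop_near1 /almost_everywhere.
rewrite /nbhs /= (_ : ~` _ = A)//; apply/seteqP; split => x /=; last by move=> Ax; apply.
exact: contrapT.
Qed.

Lemma mu_gt0P A : (0 < mu A)%E <-> mu A <> 0%E.
Proof.
by rewrite lt0e measure_ge0 andbT; split=> /eqP.
Qed.

Lemma pos_ae_pick A (P : X -> Prop) : measurable A -> (0 < mu A)%E ->
  {ae mu, forall x, P x} -> exists x, A x /\ P x.
Proof.
move=> mA /mu_gt0P A0 aeP; apply: contrapT => nAP; apply: A0.
apply/ae_not => //; apply: filterS aeP => x Px Ax; apply: nAP; by exists x.
Qed.

Lemma pos_nonempty A : measurable A -> (0 < mu A)%E -> exists x, A x.
Proof.
move=> mA A0; have [x []] := pos_ae_pick mA A0 (aeW mu (fun=> I)).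
by exists x.
Qed.

Lemma pos_ae_sub A B : measurable A -> measurable B ->
  (0 < mu A)%E -> {ae mu, forall x, A x -> B x} -> (0 < mu B)%E.
Proof.
move=> mA mB /mu_gt0P A0 AB; apply/mu_gt0P => /(ae_not mB) nB; apply: A0.
by apply/ae_not => //; apply: filterS2 AB nB => x AB nB /AB.
Qed.

Lemma pos_ae_split (I : countType) (P : I -> X -> Prop) A :
  measurable A -> (0 < mu A)%E -> (forall i, measurable [set x | P i x]) ->
  {ae mu, forall x, A x -> exists i, P i x} ->
  exists i, (0 < mu (A `&` [set x | P i x]))%E.
Proof.
move=> mA A0 mP AP; apply: contrapT => nP.
have /mu_gt0P := A0; apply; apply/ae_not => //.
have : {ae mu, forall x, forall i, ~ (A x /\ P i x)}.
  apply: ae_forallc => i; apply/(ae_not (measurableI _ _ mA (mP i))).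
  by apply: contrapT => /mu_gt0P Pi; apply: nP; exists i.
by apply: filterS2 AP => x AP nAP Ax; have [i Pi] := AP Ax; apply: (nAP i).
Qed.

End almost_everywhere.

Arguments ae_not {R d X mu A}.
Arguments mu_gt0P {R d X mu A}.

(** * Powers of T *)

Section powers.
Context (R : realType) d (X : measurableType d) (mu : probability X R).
Variable T : aut mu.
Local Notation t := (aut_iter T).
Implicit Types (x y : X) (k l : int) (A B : set X).

Lemma aut_iterS k x : t (k + 1) x = aut_map T (t k x).
Proof.
case: k => [n|[|n]]; first by rewrite -PoszD addn1.
  by rewrite /= ns_invK.
by rewrite (_ : Negz n.+1 + 1 = Negz n) //= ?ns_invK//; lia.
Qed.

Lemma aut_iterB1 k x : t (k - 1) x = ns_inv (aut_map T) (t k x).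
Proof. by rewrite -[in RHS](subrK 1 k) aut_iterS ns_funK. Qed.

Lemma aut_iterD k l x : t (k + l) x = t k (t l x).
Proof.
elim/int_rect: k => [|n IH|n IH]; first by rewrite add0r.
  by rewrite -addn1 PoszD addrAC !aut_iterS IH.
by rewrite -addn1 PoszD opprD addrAC !aut_iterB1 IH.
Qed.

Lemma aut_iterK k x : t (- k) (t k x) = x.
Proof. by rewrite -aut_iterD addNr. Qed.

Lemma aut_iterVK k x : t k (t (- k) x) = x.
Proof. by rewrite -aut_iterD subrr. Qed.

Lemma aut_iter_eq k l x y : t k x = t l y -> y = t (k - l) x.
Proof. by move=> e; rewrite addrC aut_iterD e aut_iterK. Qed.

Lemma measurable_preimage_iter k A : measurable A -> measurable [set x | A (t k x)].
Proof. by move=> mA; rewrite -[X in measurable X]setTI; exact: measurable_aut_iter. Qed.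

Lemma measurable_saturation A : measurable A ->
  measurable [set x | exists k, A (t k x)].
Proof.
by move=> mA; apply: measurable_existsc => k; exact: (measurable_preimage_iter k mA).
Qed.

Lemma ae_iter1 k (P : X -> Prop) :
  {ae mu, forall x, P x} -> {ae mu, forall x, P (t k x)}.
Proof.
move=> aeP; elim/int_rect: k => [//|n IH|n IH].
  have := ae_preimage_ns (aut_map T) IH; apply: filterS => x.
  by rewrite -addn1 PoszD aut_iterD.
have := ae_preimage_ns (ns_invm (aut_map T)) IH; apply: filterS => x.
by rewrite -addn1 PoszD opprD aut_iterD.
Qed.

(** Every power of T preserves the null sets, and an orbit is countable. *)
Lemma ae_iter (P : X -> Prop) :
  {ae mu, forall x, P x} -> {ae mu, forall x, forall k, P (t k x)}.
Proof. by move=> aeP; apply: ae_forallc => k; exact: ae_iter1. Qed.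

Section ergodicity.
Hypotheses (mu_atomless : atomless mu) (T_ergodic : ergodic T).

Lemma ergodic_invariant A : measurable A -> (forall k x, A (t k x) <-> A x) ->
  (0 < mu A)%E -> {ae mu, forall x, A x}.
Proof.
move=> mA iA /mu_gt0P A0.
have [|//|Ac] := T_ergodic mA; first by apply/seteqP; split => x /(iA 1 x).
by exists (~` A); split => //; exact: measurableC.
Qed.

Lemma orbit_of_invariant A k x :
  [set y | exists l, A (t l y)] (t k x) <-> [set y | exists l, A (t l y)] x.
Proof.
split=> -[l Al]; first by exists (l + k); rewrite aut_iterD.
by exists (l - k); rewrite -aut_iterD subrK.
Qed.

(** As mu is atomless, such a set of positive measure would split into two parts
    of positive measure, and the saturations of these parts would be disjoint
    invariant sets of positive measure. Both aperiodicity and conservativity of T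
    come from this lemma. *)
Lemma partial_transversal_null A : measurable A ->
  (forall x k, A x -> A (t k x) -> t k x = x) -> mu A = 0%E.
Proof.
move=> mA tA; apply: contrapT => /mu_gt0P A0.
have [B [mB BA B0 BA0]] : exists B, [/\ measurable B, B `<=` A, mu B <> 0%E &
    mu B <> mu A].
  apply: contrapT => nB; apply: (mu_atomless (A := A)); split => // B mB BA.
  apply: contrapT => /not_orP[B0 BA0]; apply: nB; by exists B.
have mAB : measurable (A `\` B) by exact: measurableD.
have AB0 : (0 < mu (A `\` B))%E.
  apply/mu_gt0P => AB0; apply: BA0.
  have -> : mu A = (mu B + mu (A `\` B))%E; last by rewrite AB0 adde0.
  rewrite -{1}(setDUK BA) measureU//.
  by rewrite setDE setICA setICr setI0.
have sat C : measurable C -> (0 < mu C)%E ->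
    {ae mu, forall x, exists l, C (t l x)}.
  move=> mC C0; apply: ergodic_invariant.
  - exact: measurable_saturation.
  - by move=> k x; exact: orbit_of_invariant.
  - apply: (pos_ae_sub mC _ C0 _); first exact: measurable_saturation.
    by apply: aeW => x Cx; exists 0; exact: Cx.
move: B0 => /mu_gt0P /(sat _ mB) /(pos_ae_pick mAB AB0)[x [[Ax Bx] [l Bl]]].
by apply: Bx; rewrite -(tA x l Ax)//; exact: BA.
Qed.

(** The points of A that never come back to A, in the future or in the past, meet
    each orbit at most once, so they form a null set. The boolean selects the
    direction of time. *)
Lemma recurrence A (b : bool) (M : int) : measurable A -> (0 < mu A)%E ->
  {ae mu, forall x, exists k, M < (if b then k else - k) /\ A (t k x)}.
Proof.
move=> mA A0.
have [e eE [eK eD e0]] : exists2 e : int -> int,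
    forall k, (if b then k else - k) = e k &
    [/\ involutive e, forall k l, e (k + l) = e k + e l & e 0 = 0].
  by case: b; [exists id|exists -%R] => //; split=> // k => [|l]; lia.
have eN k : e (- k) = - e k by have := eD (- k) k; rewrite addNr e0; lia.
pose io := [set x | forall m : int, exists k : int, m < e k /\ A (t k x)].
have mio : measurable io.
  apply: measurable_forallc => m; apply: measurable_existsc => k.
  by apply: measurable_andP; [exact: measurable_cstP|exact: measurable_preimage_iter].
suff : {ae mu, forall x, io x} by apply: filterS => x /(_ M)[k]; rewrite -eE; exists k.
apply: ergodic_invariant => //.
  move=> k x; split=> h m.
    have [l [ml Al]] := h (m - e k); exists (l + k).
    by rewrite aut_iterD eD; split => //; lia.
  have [l [ml Al]] := h (m + e k); exists (l - k).
  by rewrite -aut_iterD subrK eD eN; split => //; lia.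
pose last := [set x | A x /\ forall k : int, 0 < e k -> ~ A (t k x)].
have mlast : measurable last.
  apply: measurable_andP => //; apply: measurable_forallc => k.
  apply: measurable_imply; first exact: measurable_cstP.
  by apply: measurableC; exact: measurable_preimage_iter.
have last0 : mu last = 0%E.
  apply: partial_transversal_null => // x k [Ax lx] [Akx lkx].
  have [k0|k0|] := ltgtP (e k) 0; last by move=> /(congr1 e); rewrite eK e0 => ->.
    by case: (lkx (- k)); rewrite ?aut_iterK// eN; lia.
  by case: (lx _ k0).
apply: (pos_ae_sub mA mio A0 _).
move: last0 => /(ae_not mlast)/ae_iter; apply: filterS => x nlast Ax m.
apply: contrapT => nk.
(* otherwise the visits of x to A have a largest time *)
have [n nM] : exists n : nat, m <= n%:Z by exists `|m|%N; lia.
have ex : exists k : nat, `[< A (t (e k%:Z) x) >].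
  by exists 0%N; apply/asboolP; rewrite e0.
case: (@ex_maxnP (fun k : nat => `[< A (t (e k%:Z) x) >]) n ex).
  move=> k /asboolP Ak; rewrite leqNgt; apply/negP => nk'; apply: nk.
  by exists (e k%:Z); rewrite eK; split => //; lia.
move=> k /asboolP Ak kmax; apply: (nlast (e k%:Z)); split => // l l0.
rewrite -aut_iterD => Al.
have := kmax (absz (e l + k%:Z)); rewrite gez0_abs; last by lia.
by rewrite eD eK => /(_ (asboolT Al)); lia.
Qed.

End ergodicity.
End powers.

(** * Countable separation and free orbits *)

(** This is how standard Borel spaces enter the proof: two maps into X coincide on
    a measurable set, and distinct points can be separated uniformly on pieces of
    positive measure. *)
Definition countably_separated d (X : measurableType d) :=
  exists D : nat -> set X, (forall n, measurable (D n)) /\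
    forall x y, (forall n, D n x <-> D n y) -> x = y.

Lemma standard_countably_separated (R : realType) d (X : measurableType d) :
  standard_borel R X -> countably_separated X.
Proof.
move=> [P [f [hP [B /countable_injP[g gi] [Bo Bb]] fbij mf]]].
pose U n : set P := [set p | exists V, [/\ B V, g V = n & V p]].
exists (fun n => f @^-1` U n); split=> [n|x y xy].
  have oU : open (U n); last by apply/mf; exact: sub_sigma_algebra.
  rewrite (_ : U n = \bigcup_(V in B `&` [set V | g V = n]) V).
    by apply: bigcup_open => V [/Bo].
  apply/seteqP; split => p; first by move=> [V [BV gV Vp]]; exists V.
  by move=> [V [BV gV] Vp]; exists V.
apply: (bij_inj fbij); apply: contrapT => /eqP fxy.
have [A [oA Ax Ay]] := hausdorff_accessible hP fxy.
have /Bb[V [BV Vx] VA] : nbhs (f x) A.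
  by apply: open_nbhs_nbhs; split => //; exact/set_mem.
have [] : U (g V) (f y) by apply/xy; exists V.
move=> W [BW gW Wy]; move/set_mem: Ay; apply; apply: VA.
by rewrite -(gi W V) ?inE.
Qed.

Section freeness.
Context (R : realType) d (X : measurableType d) (mu : probability X R).
Hypothesis X_sep : countably_separated X.

Lemma measurable_eqfun d' (Y : measurableType d') (f g : Y -> X) :
  measurable_fun [set: Y] f -> measurable_fun [set: Y] g ->
  measurable [set x | f x = g x].
Proof.
have [D [mD sepD]] := X_sep => mf mg.
rewrite (_ : [set _ | _] = [set x | forall n, D n (f x) <-> D n (g x)]); last first.
  by apply/seteqP; split => x /= => [->//|/sepD].
by apply: measurable_forallc => n; apply: measurable_ifP;
  rewrite -[X in measurable X]setTI; [exact: mf|exact: mg].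
Qed.

Variable T : aut mu.
Local Notation t := (aut_iter T).
Implicit Types (x y : X) (k l : int) (A B : set X).

Definition disjoint_translates (I : Type) (kappa : I -> int) A :=
  forall i j x y, A x -> A y -> t (kappa i) x = t (kappa j) y -> i = j.

Lemma disjoint_translatesS (I : Type) (kappa : I -> int) A B :
  A `<=` B -> disjoint_translates kappa B -> disjoint_translates kappa A.
Proof. by move=> AB dB i j x y Ax Ay; apply: dB; exact: AB. Qed.

(** For almost every x in A some sets of the separating family distinguish the
    finitely many translates of x; fixing the choice of these sets on a piece of A of
    positive measure makes the translates of that piece disjoint. *)
Lemma ex_disjoint_translates (I : finType) (kappa : I -> int) A :
  measurable A -> (0 < mu A)%E ->
  {ae mu, forall x, A x -> forall i j, t (kappa i) x = t (kappa j) x -> i = j} ->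
  exists B, [/\ measurable B, B `<=` A, (0 < mu B)%E & disjoint_translates kappa B].
Proof.
move=> mA A0 Afree; have [D [mD sepD]] := X_sep.
pose sep (i j : I) (c : nat * bool) x :=
  (D c.1 (t (kappa i) x) <-> c.2) /\ (D c.1 (t (kappa j) x) <-> ~~ c.2).
pose P (c : {ffun I * I -> nat * bool}) x :=
  forall p, p.1 != p.2 -> sep p.1 p.2 (c p) x.
have mP c : measurable [set x | P c x].
  apply: measurable_forallc => p; apply: measurable_imply; first exact: measurable_cstP.
  by apply: measurable_andP; apply: measurable_ifP; (exact: measurable_cstP) ||
    exact: measurable_preimage_iter.
have [|c Pc0] := pos_ae_split mA A0 mP.
  apply: filterS Afree => x xfree Ax.
  have /choice[c cP] : forall p : I * I, exists c, p.1 != p.2 -> sep p.1 p.2 c x.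
    move=> [i j] /=; have [->|ij] := eqVneq i j; first by exists (0%N, true).
    have : ~ forall n, D n (t (kappa i) x) <-> D n (t (kappa j) x).
      by move=> /sepD /(xfree Ax) /eqP; rewrite (negPf ij).
    move=> /existsNP[n nD]; exists (n, `[< D n (t (kappa i) x) >]) => _.
    rewrite /sep /=; case: (pselect (D n (t (kappa i) x))) => Di.
      by rewrite asboolT//=; split; split => // Dj; case: nD.
    by rewrite asboolF//=; split; split => // _; apply: contrapT => Dj; case: nD.
  by exists [ffun p => c p] => p; rewrite ffunE; exact: cP.
exists (A `&` [set x | P c x]); split => //; first exact: measurableI.
move=> i j x y [_ /= Px] [_ /= Py] e; apply/eqP/negPn/negP => ij.
have [Pxi _] := Px (i, j) ij; have [_ Pyj] := Py (i, j) ij; rewrite /= e in Pxi.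
by case: (c (i, j)).2 Pxi Pyj => /= -[a b] [a' b'];
  [have := a' (b isT)|have := a (b' isT)].
Qed.

Hypotheses (mu_atomless : atomless mu) (T_ergodic : ergodic T).

(** Otherwise the points of minimal period n contain a set of positive measure
    disjoint from its first n - 1 translates, and that set meets each orbit at most
    once. *)
Lemma aperiodic_step (n : nat) : (0 < n)%N ->
  {ae mu, forall x, forall m : nat, (0 < m < n)%N -> t m%:Z x <> x} ->
  {ae mu, forall x, t n%:Z x <> x}.
Proof.
move=> n0 IH; pose F := [set x | t n%:Z x = x].
have mF : measurable F.
  by apply: measurable_eqfun; [exact: measurable_aut_iter|exact: measurable_id].
apply/(ae_not mF); apply: contrapT => /mu_gt0P F0.
have Fq q x : F x -> t (q * n%:Z) x = x.
  move=> Fx; elim/int_rect: q => [|q IHq|q IHq]; first by rewrite mul0r.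
    by rewrite -addn1 PoszD mulrDl mul1r aut_iterD Fx.
  rewrite -addn1 PoszD opprD mulrDl mulN1r aut_iterD.
  by rewrite -{1}Fx aut_iterK.
have [|B [mB BF B0 dB]] := @ex_disjoint_translates 'I_n (fun i => i%:Z) F mF F0.
  apply: filterS IH => x IH Fx i j /aut_iter_eq e; apply/val_inj/eqP.
  have := IH (absz (i%:Z - j%:Z)); have := ltn_ord i; have := ltn_ord j.
  have [ij|ij ltj lti|//] := ltgtP (i : nat) j.
    move=> ltj lti /(_ _) nIH; exfalso; apply: nIH; first lia.
    rewrite {1}e (_ : Posz (absz _) = - (i%:Z - j%:Z)); last by lia.
    exact: aut_iterK.
  move=> nIH; exfalso; apply: nIH; first lia.
  by rewrite gez0_abs; [exact/esym|lia].
move/mu_gt0P: B0; apply; apply: (partial_transversal_null mu_atomless T_ergodic) => //.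
move=> x k Bx Bk.
have tk : t k x = t (k %% n%:Z)%Z x.
  by rewrite {1}(divz_eq k n%:Z) addrC aut_iterD (Fq _ x (BF _ Bx)).
have r0 : (k %% n%:Z)%Z >= 0 by apply: modz_ge0; lia.
have rn : (absz (k %% n%:Z)%Z < n)%N by have := @ltz_mod k n%:Z; lia.
have e : t (Posz (absz (k %% n%:Z)%Z)) x = t 0%:Z (t k x) by rewrite tk gez0_abs.
have /(congr1 val)/= := dB (Ordinal rn) (Ordinal n0) x (t k x) Bx Bk e.
by rewrite tk => k0; rewrite (_ : (k %% n%:Z)%Z = 0)//; lia.
Qed.

Lemma aperiodic : {ae mu, forall x, forall k l, t k x = t l x -> k = l}.
Proof.
have pos (n : nat) : {ae mu, forall x, forall m : nat, (0 < m < n)%N -> t m%:Z x <> x}.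
  elim: n => [|[|n] IH]; [by apply: aeW => x m; lia|by apply: aeW => x m; lia|].
  have := aperiodic_step (ltn0Sn n) IH; apply: filterS2 IH => x IH nx m.
  move=> /andP[m0]; rewrite ltnS leq_eqVlt => /predU1P[->//|mn].
  by apply: IH; rewrite m0.
have := ae_foralln pos; apply: filterS => x free k l.
have main a b : a <= b -> t a x = t b x -> a = b.
  move=> ab /esym e; have {e} e : t (b - a) x = x.
    by rewrite addrC aut_iterD e aut_iterK.
  have [b0|b0] := eqVneq (b - a) 0; first lia.
  case: (free (absz (b - a)).+1 (absz (b - a))); first lia.
  by rewrite gez0_abs//; lia.
by have [kl|/ltW kl e] := leP k l; [exact: main|exact/esym/main].
Qed.

Lemma ex_tower (I : finType) (kappa : I -> int) A : injective kappa ->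
  measurable A -> (0 < mu A)%E ->
  exists B, [/\ measurable B, B `<=` A, (0 < mu B)%E & disjoint_translates kappa B].
Proof.
move=> ki mA A0; apply: ex_disjoint_translates => //.
by apply: filterS aperiodic => x free _ i j /free /ki.
Qed.

End freeness.

(** * Representatives of classes of transformations *)

Section representatives.
Context (R : realType) d (X : measurableType d) (mu : {measure set X -> \bar R}).
Implicit Types (S : aut mu) (f : nonsingular_map mu).

Lemma aut_classE f : {ae mu, forall x, aut_map (aut_class f) x = f x}.
Proof. by apply/ns_eqP/aut_classP; rewrite aut_mapK. Qed.

Lemma aut_eqP S S' : S = S' <-> {ae mu, forall x, aut_map S x = aut_map S' x}.
Proof.
split=> [->|e]; first exact: aeW.
by rewrite -(aut_mapK S) -(aut_mapK S'); apply/aut_classP/ns_eqP.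
Qed.

Lemma aut_mulE S S' :
  {ae mu, forall x, aut_map (S * S')%g x = aut_map S (aut_map S' x)}.
Proof. exact: (aut_classE (ns_mul (aut_map S) (aut_map S'))). Qed.

Lemma aut_invE S : {ae mu, forall x, aut_map S^-1%g x = ns_inv (aut_map S) x}.
Proof. exact: (aut_classE (ns_invm (aut_map S))). Qed.

Lemma aut_oneE : {ae mu, forall x, aut_map (1%g : aut mu) x = x}.
Proof. exact: (aut_classE (ns_one mu)). Qed.

Lemma aut_map_inj S : injective (aut_map S).
Proof. exact: can_inj (@ns_funK _ _ _ _ (aut_map S)). Qed.

End representatives.

(** * Membership in the commensurating full group *)

Section membership.
Context (R : realType) d (X : measurableType d) (mu : probability X R).
Variable T : aut mu.
Hypothesis X_sep : countably_separated X.
Local Notation t := (aut_iter T).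
Hypothesis T_free : {ae mu, forall x, forall k l, t k x = t l x -> k = l}.
Implicit Types (x y : X) (k l : int) (S : aut mu).

Definition acts_as S x (s : int -> int) :=
  forall n, aut_map S (t n x) = t (s n) x.

Lemma acts_as_unique S x (s s' : int -> int) :
  (forall k l, t k x = t l x -> k = l) ->
  acts_as S x s -> acts_as S x s' -> s =1 s'.
Proof. by move=> free Ss Ss' n; apply: free; rewrite -Ss. Qed.

Lemma measurable_fun_int (c : X -> int) :
  (forall k, measurable [set x | c x = k]) -> measurable_fun [set: X] c.
Proof.
move=> mc _ A _; rewrite setTI.
rewrite (_ : _ @^-1` _ = [set x | exists k, A k /\ c x = k]).
  by apply: measurable_existsc => k; apply: measurable_andP => //; exact: measurable_cstP.
by apply/seteqP; split => x /=; [exists (c x)|move=> [k [Ak ->]]].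
Qed.

Lemma measurable_int_fiber (c : X -> int) k :
  measurable_fun [set: X] c -> measurable [set x | c x = k].
Proof. by move=> mc; rewrite -[X in measurable X]setTI; exact: (mc _ [set k]). Qed.

(** Choosing the first suitable exponent in an enumeration of the integers
    makes the cocycle measurable. *)
Lemma cocycleP S : full_group T S ->
  {ae mu, forall x, aut_map S x = t (cocycle T S x) x}.
Proof.
move=> TS; pose E k := [set x | aut_map S x = t k x].
have mE k : measurable (E k).
  by apply: measurable_eqfun => //; [exact: measurable_ns_fun|exact: measurable_aut_iter].
pose F k x := E k x /\ forall j : int, (pickle j < pickle k)%N -> ~ E j x.
have mF k : measurable [set x | F k x].
  apply: measurable_andP; first exact: mE.
  apply: measurable_forallc => j.
  by apply: measurable_imply; [exact: measurable_cstP|exact: measurableC].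
have Funiq x k l : F k x -> F l x -> k = l.
  move=> [Ek Fk] [El Fl]; have [kl|kl|] := ltngtP (pickle k) (pickle l).
  - by case: (Fl _ kl).
  - by case: (Fk _ kl).
  - exact: (pcan_inj pickleK).
pose c x := xget 0 [set k | F k x].
suff : is_cocycle T S (cocycle T S) by case.
apply: (@xgetPex _ _ (is_cocycle T S)); exists c; split.
  apply: measurable_fun_int => k.
  rewrite (_ : [set _ | _] = [set x | F k x] `|`
      [set x | k = 0 /\ ~ exists j, F j x]).
    apply: measurableU => //; apply: measurable_andP; first exact: measurable_cstP.
    by apply: measurableC; exact: measurable_existsc.
  apply/seteqP; split => x /=; rewrite /c.
    by case: xgetP => [j -> Fj <-|nF <-]; [left|right; split=> // -[j]; exact: nF].
  move=> [Fk|[-> nF]]; last by apply: xgetPN => j Fj; apply: nF; exists j.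
  by apply: (Funiq x) => //; apply: (@xgetPex _ 0 [set k | F k x]); exists k.
apply: filterS TS => x [k Ek].
have exF : exists k, F k x.
  have : exists n : nat, `[< exists k, pickle k = n /\ E k x >].
    by exists (pickle k); apply/asboolP; exists k.
  move=> /ex_minnP[n /asboolP[j [jn Ej]] nmin]; exists j; split => // i ij Ei.
  have /nmin : `[< exists k, pickle k = pickle i /\ E k x >].
    by apply/asboolP; exists i.
  by rewrite leqNgt -jn ij.
by have [] := @xgetPex _ 0 [set k | F k x] exF.
Qed.

Lemma acts_as_cocycle S : full_group T S ->
  {ae mu, forall x, acts_as S x (cocycle_perm T S x)}.
Proof.
move=> /cocycleP/(ae_iter T); apply: filterS => x Sx n.
by rewrite Sx -aut_iterD addrC.
Qed.

Lemma com_full_groupP S : com_full_group T S <->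
  {ae mu, forall x, exists s : symZN, acts_as S x s}.
Proof.
split=> [[TS cS]|exs].
  have aS := acts_as_cocycle TS.
  apply: filterS2 aS cS => x Sx /commensurating_ex[s sE].
  by exists s => n; rewrite sE; exact: Sx.
have TS : full_group T S.
  by apply: filterS exs => x [s /(_ 0) Sx]; exists (s 0).
split=> //; have aS := acts_as_cocycle TS; apply: filterS3 exs T_free aS => x [s Sx] free Cx; apply/commensurating_ex; exists s.
exact: acts_as_unique Sx Cx.
Qed.

Lemma acts_as_mul S S' x (s s' : int -> int) :
  (forall n, aut_map (S * S')%g (t n x) = aut_map S (aut_map S' (t n x))) ->
  acts_as S x s -> acts_as S' x s' -> acts_as (S * S')%g x (s \o s').
Proof. by move=> SS' Ss Ss' n; rewrite SS' Ss' Ss. Qed.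

Lemma acts_as_inv S x (s : symZN) :
  (forall n, aut_map S^-1%g (t n x) = ns_inv (aut_map S) (t n x)) ->
  acts_as S x s -> acts_as S^-1%g x (sym_inv s).
Proof.
move=> S' Ss n; rewrite S'; apply: (@aut_map_inj _ _ _ _ S).
by rewrite ns_invK Ss sym_invK.
Qed.

Lemma com_full_group_subgroup : is_subgroup (com_full_group T).
Proof.
split.
  apply/com_full_groupP; apply: filterS (ae_iter T (aut_oneE mu)) => x Sx.
  by exists 1%g => n; rewrite Sx.
move=> S S' /com_full_groupP GS /com_full_groupP GS'; apply/com_full_groupP.
have E := ae_andP (ae_iter T (aut_invE S')) (ae_iter T (aut_mulE S S'^-1%g)).
apply: filterS3 GS GS' E => x [s Ss] [s' Ss'] [E1 E2].
by exists (s * s'^-1)%g; apply: acts_as_mul E2 Ss _; exact: acts_as_inv.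
Qed.

End membership.

(** * Transformations permuting the levels of a tower *)

Section piecewise_powers.
Context (R : realType) d (X : measurableType d) (mu : probability X R).
Variable T : aut mu.
Local Notation t := (aut_iter T).
Variables (f g : X -> X) (c c' : X -> int).
Hypotheses (fK : cancel f g) (gK : cancel g f)
  (mc : measurable_fun [set: X] c) (mc' : measurable_fun [set: X] c')
  (fE : forall x, f x = t (c x) x) (gE : forall x, g x = t (c' x) x).

Lemma measurable_piecewise_power (h : X -> X) (e : X -> int) :
  measurable_fun [set: X] e -> (forall x, h x = t (e x) x) ->
  measurable_fun [set: X] h.
Proof.
move=> me hE _ A mA; rewrite setTI.
rewrite (_ : _ @^-1` _ = [set x | exists k, e x = k /\ A (t k x)]).
  apply: measurable_existsc => k; apply: measurable_andP.
    exact: measurable_int_fiber.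
  exact: measurable_preimage_iter.
by apply/seteqP; split => x /=; rewrite hE; [exists (e x)|move=> [k [->]]].
Qed.

Lemma piecewise_power_null A : measurable A ->
  pushforward mu f A = 0%E <-> mu A = 0%E.
Proof.
have sub (h : X -> X) (e : X -> int) (P : X -> Prop) :
    (forall x, h x = t (e x) x) ->
    {ae mu, forall x, P x} -> {ae mu, forall x, P (h x)}.
  by move=> hE /(ae_iter T); apply: filterS => x Px; rewrite hE.
move=> mA; rewrite /pushforward.
have mfA : measurable (f @^-1` A).
  rewrite -[X in measurable X]setTI.
  exact: (measurable_piecewise_power mc fE measurableT mA).
rewrite -(ae_not mA) -(ae_not mfA); split; last exact: (sub f c).
by move=> /(sub g c' _ gE); apply: filterS => x; rewrite /preimage /= gK.
Qed.

Definition piecewise_power : nonsingular_map mu :=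
  NonsingularMap fK gK (measurable_piecewise_power mc fE)
    (measurable_piecewise_power mc' gE) piecewise_power_null.

End piecewise_powers.

Section towers.
Context (R : realType) d (X : measurableType d) (mu : probability X R).
Variable T : aut mu.
Local Notation t := (aut_iter T).
Implicit Types (x y b : X) (k l : int) (S : aut mu).

Record tower (I : finType) := Tower {
  tbase : set X ;
  theight : I -> int ;
  measurable_tbase : measurable tbase ;
  theight_disjoint : disjoint_translates T theight tbase
}.

Section permutation_of_levels.
Variables (I : finType) (P : tower I).
Local Notation h := (theight P).
Implicit Types (s : {perm I}) (i j : I).

Definition level i : set X := [set x | tbase P (t (- h i) x)].

Lemma levelP i x : level i x <-> exists2 b, tbase P b & x = t (h i) b.
Proof.
split=> [Lx|[b Pb ->]]; last by rewrite /level /= aut_iterK.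
by exists (t (- h i) x) => //; rewrite aut_iterVK.
Qed.

Lemma level_inj i j x : level i x -> level j x -> i = j.
Proof.
move=> /levelP[b Pb ->] /levelP[b' Pb' e].
exact: (theight_disjoint Pb Pb' e).
Qed.

Definition tower_shift s x : int :=
  if [pick i | `[< level i x >]] is Some i then h (s i) - h i else 0.

Lemma tower_shift_level s i x : level i x -> tower_shift s x = h (s i) - h i.
Proof.
move=> Lx; rewrite /tower_shift; case: pickP => [j /asboolP Lj|/(_ i)].
  by rewrite (level_inj Lj Lx).
by rewrite asboolT.
Qed.

Lemma tower_shift_off s x : (forall i, ~ level i x) -> tower_shift s x = 0.
Proof.
by move=> nL; rewrite /tower_shift; case: pickP => // j /asboolP /nL.
Qed.

Lemma measurable_level i : measurable (level i).
Proof. exact: measurable_preimage_iter (measurable_tbase P). Qed.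

Lemma measurable_tower_shift s : measurable_fun [set: X] (tower_shift s).
Proof.
apply: measurable_fun_int => k.
rewrite (_ : [set _ | _] = [set x | exists i, h (s i) - h i = k /\ level i x] `|`
    [set x | 0 = k /\ ~ exists i, level i x]).
  apply: measurableU; last apply: measurable_andP.
  - apply: measurable_existsc => i; apply: measurable_andP.
      exact: measurable_cstP.
    exact: measurable_level.
  - exact: measurable_cstP.
  - by apply/measurableC/measurable_existsc => i; exact: measurable_level.
apply/seteqP; split => x /=.
  have [[i Li]|nL] := pselect (exists i, level i x).
    by rewrite (tower_shift_level _ Li) => <-; left; exists i.
  rewrite tower_shift_off; first by right.
  by move=> i Li; apply: nL; exists i.
move=> [[i [<- Li]]|[<- nL]]; first exact: tower_shift_level.
by apply: tower_shift_off => i Li; apply: nL; exists i.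
Qed.

Definition tower_fun s x := t (tower_shift s x) x.

Lemma tower_fun_level s i b : tbase P b -> tower_fun s (t (h i) b) = t (h (s i)) b.
Proof.
move=> Pb; rewrite /tower_fun (@tower_shift_level s i); last by apply/levelP; exists b.
by rewrite -aut_iterD subrK.
Qed.

Lemma tower_fun_off s x : (forall i, ~ level i x) -> tower_fun s x = x.
Proof. by move=> /(tower_shift_off s); rewrite /tower_fun => ->. Qed.

Lemma tower_fun_comp s s' x : tower_fun s (tower_fun s' x) = tower_fun (s' * s)%g x.
Proof.
have [[i /levelP[b Pb ->]]|nL] := pselect (exists i, level i x).
  by rewrite !tower_fun_level// permM.
by rewrite !tower_fun_off// => i Li; apply: nL; exists i.
Qed.

Lemma tower_fun1 x : tower_fun 1%g x = x.
Proof.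
have [[i /levelP[b Pb ->]]|nL] := pselect (exists i, level i x).
  by rewrite !tower_fun_level// perm1.
by rewrite !tower_fun_off// => i Li; apply: nL; exists i.
Qed.

Lemma tower_funK s : cancel (tower_fun s) (tower_fun s^-1%g).
Proof. by move=> x; rewrite tower_fun_comp mulgV tower_fun1. Qed.

Lemma tower_funVK s : cancel (tower_fun s^-1%g) (tower_fun s).
Proof. by move=> x; rewrite tower_fun_comp mulVg tower_fun1. Qed.

Definition tower_map s : nonsingular_map mu :=
  piecewise_power (tower_funK s) (tower_funVK s) (measurable_tower_shift s)
    (measurable_tower_shift s^-1) (fun=> erefl) (fun=> erefl).

(** Permutations compose from left to right and transformations from right to
    left; the inverse makes this a group morphism. *)
Definition tower_perm s : aut mu := aut_class (tower_map s^-1).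

Lemma tower_permE s :
  {ae mu, forall x, aut_map (tower_perm s) x = tower_fun s^-1%g x}.
Proof. exact: aut_classE. Qed.

Lemma tower_permM s s' : tower_perm (s * s')%g = (tower_perm s * tower_perm s')%g.
Proof.
rewrite /tower_perm -[RHS]aut_class_mul; apply: aut_class_eq => x /=.
by rewrite tower_fun_comp invMg.
Qed.

Lemma tower_perm1 : tower_perm 1%g = 1%g.
Proof. by apply: aut_class_eq => x /=; rewrite invg1 tower_fun1. Qed.

Lemma tower_permV s : tower_perm s^-1%g = (tower_perm s)^-1%g.
Proof.
by apply: (@mulgI _ (tower_perm s)); rewrite -tower_permM !mulgV tower_perm1.
Qed.

End permutation_of_levels.

Lemma finite_window (m : nat) : finite_set [set n : int | (absz n <= m)%N].
Proof.
apply: (@sub_finite_set _ _ [set` map (fun i => i%:Z - m%:Z) (iota 0 (m + m).+1)]).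
  move=> n nm; have {}nm : (absz n <= m)%N := nm; apply/mapP; exists (absz (n + m%:Z)); last lia.
  by rewrite mem_iota; lia.
exact: finite_seq.
Qed.

(** Only integers within K of 0 can be moved across 0. *)
Lemma commN_bounded (s s' : int -> int) (K : int) : cancel s' s ->
  (forall n, - K <= s n - n <= K) -> commN (s @` natZ).
Proof.
move=> s'K sB; apply: (sub_finite_set _ (finite_window (absz K))).
move=> y [[[n + <-]]|[y0 sy]]; first by have := sB n; rewrite /natZ /=; lia.
apply: contrapT => yK; apply: sy; exists (s' y); rewrite ?s'K//.
by have := sB (s' y); rewrite s'K; move: yK y0; rewrite /natZ /=; lia.
Qed.

Hypothesis X_sep : countably_separated X.
Hypothesis T_free : {ae mu, forall x, forall k l, t k x = t l x -> k = l}.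

Lemma tower_perm_com (I : finType) (P : tower I) (s : {perm I}) :
  com_full_group T (tower_perm P s).
Proof.
apply/com_full_groupP => //.
pose K : int := \sum_i \sum_j `|theight P i - theight P j|.
have KE i j : `|theight P i - theight P j| <= K.
  rewrite /K (bigD1 i)//= (bigD1 j)//= -addrA lerDl addr_ge0//.
    by apply: sumr_ge0.
  by apply: sumr_ge0 => k _; apply: sumr_ge0.
have K0 : 0 <= K by apply: sumr_ge0 => k _; apply: sumr_ge0.
have shK (u : {perm I}) x : - K <= tower_shift P u x <= K.
  have [[i Li]|nL] := pselect (exists i, level P i x).
    by rewrite (tower_shift_level _ Li); have := KE (u i) i; lia.
  rewrite tower_shift_off; first lia.
  by move=> i Li; apply: nL; exists i.
apply: filterS2 (ae_iter T (tower_permE P s)) T_free => x E free.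
pose sg (u : {perm I}) (n : int) := n + tower_shift P u (t n x).
have sgE u n : tower_fun P u (t n x) = t (sg u n) x.
  by rewrite /tower_fun -aut_iterD addrC.
have sgK : cancel (sg s^-1%g) (sg s).
  by move=> n; apply: free; rewrite -!sgE tower_funVK.
have sgVK : cancel (sg s) (sg s^-1%g).
  by move=> n; apply: free; rewrite -!sgE tower_funK.
have sgB n : - K <= sg s^-1%g n - n <= K by rewrite /sg addrAC subrr add0r.
exists (SymZN sgK sgVK (commN_bounded sgVK sgB)) => n.
by rewrite E sgE.
Qed.

End towers.

(** * Limits in the commensurating full group *)

Lemma decreasing_null_small (R : realType) d (X : measurableType d)
    (mu : probability X R) (E : nat -> set X) (e : R) :
  (forall n, measurable (E n)) -> (forall m n, (m <= n)%N -> E n `<=` E m) ->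
  {ae mu, forall x, exists n, ~ E n x} -> 0 < e -> exists n, (mu (E n) < e%:E)%E.
Proof.
move=> mE dE E0 e0.
have mI : measurable (\bigcap_n E n) by exact: bigcap_measurableType.
have cv : mu (E n) @[n --> \oo] --> mu (\bigcap_n E n).
  apply: nonincreasing_cvg_mu => //.
    by rewrite (le_lt_trans (probability_le1 _ _))// ltry.
  by move=> m n mn; rewrite subsetEset; exact: dE.
have I0 : mu (\bigcap_n E n) = 0%E.
  apply/(ae_not mI); apply: filterS E0 => x [n nE] IE; exact/nE/IE.
have : nbhs (mu (\bigcap_n E n)) [set y : \bar R | (y < e%:E)%E].
  apply: open_nbhs_nbhs; split; first exact: open_ereal_lt_ereal.
  by rewrite /= I0 lte_fin.
move=> /cv[n _ nE]; exists n; exact: (nE n (leqnn n)).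
Qed.

Lemma commN_window (F : set (set int)) : finite_set F -> F `<=` commN ->
  exists m : nat, forall M, F M -> forall n : int, (m < absz n)%N -> (M n <-> natZ n).
Proof.
move=> /finite_seqP[l ->]; elim: l => [|M l IH] lF; first by exists 0%N.
have [|m mP] := IH; first by move=> N Nl; apply: lF; rewrite /= inE Nl orbT.
have /finite_seqP[a aE] : commN M by apply: lF; rewrite /= inE eqxx.
exists (maxn m (\max_(n <- a) absz n))%N => N /=; rewrite inE => /predU1P[->|Nl] n.
  rewrite gtn_max => /andP[_ an]; have : ~ (M `+` natZ) n.
    rewrite aE => /= na; move: an; rewrite ltnNge; apply/negP/negPn.
    exact: (leq_bigmax_seq (F := absz)).
  by rewrite /setY /=; move: (EM (M n)) (EM (natZ n)); tauto.
by rewrite gtn_max => /andP[mn _]; exact: mP mn.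
Qed.

(** The topology of Sym(Z, N) is thus that of pointwise convergence together with
    the convergence of the images of N. *)
Lemma stabilizer_window (F : set (set int)) (m : nat) (r : symZN) :
  (forall M, F M -> forall n : int, (m < absz n)%N -> (M n <-> natZ n)) ->
  (forall n : int, (absz n <= m)%N -> r n = n) -> r @` natZ = natZ ->
  stabilizer F r.
Proof.
move=> FM rm rN M MF; have {}FM := FM M MF; have rinj := can_inj (@sym_funK r).
have far n : (m < absz n)%N -> (m < absz (r n))%N.
  move=> mn; rewrite ltnNge; apply/negP => rnm; have /rinj e := rm _ rnm.
  by rewrite e leqNgt mn in rnm.
have natE n : natZ (r n) <-> natZ n.
  split=> [|nn]; last by rewrite -rN; exists n.
  by rewrite -{1}rN => -[k nk /rinj <-].
apply/seteqP; split => [_ [n Mn <-]|n Mn].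
  have [nm|nm] := leqP (absz n) m; first by rewrite rm.
  by apply/FM; [exact: far|apply/natE/FM].
have [nm|nm] := leqP (absz n) m; first by exists n => //; exact: rm.
exists (sym_inv r n); last exact: sym_invK.
have [km|km] := leqP (absz (sym_inv r n)) m.
  by move: (rm _ km); rewrite sym_invK => <-.
by apply/FM => //; apply/natE; rewrite sym_invK; exact/FM.
Qed.

Section limits.
Context (R : realType) d (X : measurableType d) (mu : probability X R).
Variable T : aut mu.
Hypothesis X_sep : countably_separated X.
Local Notation t := (aut_iter T).
Hypothesis T_free : {ae mu, forall x, forall k l, t k x = t l x -> k = l}.
Implicit Types (x y : X) (k l : int) (S : aut mu).

Lemma L0_fun_Phi S : com_full_group T S ->
  {ae mu, forall x, forall s : symZN, acts_as T S x s -> L0_fun (Phi T S) x = s}.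
Proof.
move=> GS; have [TS _] := GS.
have aS := acts_as_cocycle X_sep TS.
apply: filterS3 (Phi_ae GS) T_free aS => x PhiS free Cx s Sx.
apply: symZN_eq => n; rewrite PhiS.
exact: acts_as_unique free Cx Sx n.
Qed.

(** Closeness in G can be read off the action on orbits: it is enough to compare
    the images of a finite window and of the positive half-orbit. *)
Lemma closed_approx (C : set (aut_com T)) S : closed C -> com_full_group T S ->
  (forall (m : nat) (e : R), 0 < e -> exists S', [/\ com_full_group T S', C S' &
    exists E, [/\ measurable E, (mu E < e%:E)%E &
      {ae mu, forall x, ~ E x -> exists s s' : symZN,
        [/\ acts_as T S x s, acts_as T S' x s',
            forall n : int, (absz n <= m)%N -> s n = s' n &
            s @` natZ = s' @` natZ]}]]) -> C S.
Proof.
move=> cC GS approx; apply: cC => B; rewrite nbhsE.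
move=> [W [[A oA <-] /= AS] OB].
have [U [e [[F [F0 cF FU]] e0 UA]]] : nbhs (Phi T S) A by exact: open_nbhs_nbhs.
have [m mP] := commN_window F0 cF.
have [S' [GS' CS' [E [mE Ee SE]]]] := approx m e e0.
exists S'; split=> //; apply: OB; apply: UA.
have : {ae mu, forall x, ~ E x -> U ((L0_fun (Phi T S) x)^-1 *
    L0_fun (Phi T S') x)%g}.
  have := ae_andP (L0_fun_Phi GS) (L0_fun_Phi GS').
  apply: filterS2 SE => x SE [PS PS'] /SE[s [s' [Ss Ss' ss' ssN]]].
  rewrite (PS _ Ss) (PS' _ Ss'); apply: FU; rewrite invg1 mul1g.
  apply: (stabilizer_window mP) => [n nm|].
    by rewrite sym_mulE -ss'//; exact: sym_funK.
  by rewrite sym_imageM -ssN; exact: sym_invE.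
move=> [Z [mZ Z0 nZ]]; exists (E `|` Z); split; first exact: measurableU.
  apply: le_lt_trans (measureU2 _ mE mZ) _.
  by rewrite [X in (_ + X)%E](_ : _ = 0%E) ?adde0.
move=> x /not_orP[nE nZx]; apply: contrapT => nU; apply: nZx; apply: nZ => /=.
by move=> h; apply: nU; exact: h.
Qed.

(** ** Restrictions to invariant sets *)

Record invariant_set (S : aut mu) := InvariantSet {
  iset :> X -> Prop ;
  measurable_iset : measurable [set x | iset x] ;
  iset_inv : forall x, iset (aut_map S x) <-> iset x
}.

Section restriction.
Variables (S : aut mu) (Y : invariant_set S).
Local Notation f := (aut_map S).

Definition restrict_fun (g : X -> X) x := if `[< Y x >] then g x else x.

Lemma restrict_in (g : X -> X) x : Y x -> restrict_fun g x = g x.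
Proof. by move=> Yx; rewrite /restrict_fun asboolT. Qed.

Lemma restrict_out (g : X -> X) x : ~ Y x -> restrict_fun g x = x.
Proof. by move=> Yx; rewrite /restrict_fun asboolF. Qed.

Lemma iset_invV x : Y (ns_inv f x) <-> Y x.
Proof. by rewrite -{2}[x](@ns_invK _ _ _ _ f) iset_inv. Qed.

Lemma restrict_funK : cancel (restrict_fun f) (restrict_fun (ns_inv f)).
Proof.
move=> x; have [Yx|Yx] := pselect (Y x); last by rewrite !restrict_out.
by rewrite (restrict_in _ Yx) restrict_in ?iset_inv// ns_funK.
Qed.

Lemma restrict_funVK : cancel (restrict_fun (ns_inv f)) (restrict_fun f).
Proof.
move=> x; have [Yx|Yx] := pselect (Y x); last by rewrite !restrict_out.
by rewrite (restrict_in _ Yx) restrict_in ?iset_invV// ns_invK.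
Qed.

Lemma measurable_restrict g : measurable_fun [set: X] g ->
  measurable_fun [set: X] (restrict_fun g).
Proof.
move=> mg _ A mA; rewrite setTI (_ : _ @^-1` _ =
    [set x | (Y x -> A (g x)) /\ (~ Y x -> A x)]).
  apply: measurable_andP; apply: measurable_imply => //.
  - exact: measurable_iset.
  - by rewrite -[X in measurable X]setTI; exact: mg.
  - by apply: measurableC; exact: measurable_iset.
apply/seteqP; split => x /=; have [Yx|Yx] := pselect (Y x).
- by rewrite restrict_in.
- by rewrite restrict_out.
- by rewrite restrict_in// => -[+ _]; exact.
- by rewrite restrict_out// => -[_]; exact.
Qed.

Lemma restrict_null A : measurable A ->
  pushforward mu (restrict_fun f) A = 0%E <-> mu A = 0%E.
Proof.
have sub (g : nonsingular_map mu) (P : X -> Prop) :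
    {ae mu, forall x, P x} -> {ae mu, forall x, P (restrict_fun g x)}.
  move=> aeP; apply: filterS2 (ae_preimage_ns g aeP) aeP => x Pg Px.
  have [Yx|Yx] := pselect (Y x); first by rewrite restrict_in.
  by rewrite restrict_out.
move=> mA; rewrite /pushforward.
have mfA : measurable (restrict_fun f @^-1` A).
  rewrite -[X in measurable X]setTI.
  exact: (measurable_restrict (measurable_ns_fun f) measurableT mA).
rewrite -(ae_not mA) -(ae_not mfA); split; last exact: (sub f).
by move=> /(sub (ns_invm f)); apply: filterS => x; rewrite /preimage /= restrict_funVK.
Qed.

Definition restriction_map : nonsingular_map mu :=
  NonsingularMap restrict_funK restrict_funVK
    (measurable_restrict (measurable_ns_fun f))
    (measurable_restrict (measurable_ns_inv f)) restrict_null.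

Definition restriction : aut mu := aut_class restriction_map.

Lemma restrictionE : {ae mu, forall x, aut_map restriction x = restrict_fun f x}.
Proof. exact: aut_classE. Qed.

Section restricted_permutation.
Variables (s : symZN) (x : X).
Hypothesis Sx : acts_as T S x s.

Let restrict_sym (u : int -> int) n := if `[< Y (t n x) >] then u n else n.

Let iset_sym n : Y (t (s n) x) <-> Y (t n x).
Proof. by rewrite -Sx iset_inv. Qed.

Let iset_symV n : Y (t (sym_inv s n) x) <-> Y (t n x).
Proof. by rewrite -{2}[n](@sym_invK s) iset_sym. Qed.

Let restrict_symK : cancel (restrict_sym s) (restrict_sym (sym_inv s)).
Proof.
move=> n; rewrite /restrict_sym; case: (asboolP (Y (t n x))) => Yn.
  by rewrite asboolT ?iset_sym// sym_funK.
by rewrite asboolF.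
Qed.

Let restrict_symVK : cancel (restrict_sym (sym_inv s)) (restrict_sym s).
Proof.
move=> n; rewrite /restrict_sym; case: (asboolP (Y (t n x))) => Yn.
  by rewrite asboolT ?iset_symV// sym_invK.
by rewrite asboolF.
Qed.

Let restrict_sym_comm : commN (restrict_sym s @` natZ).
Proof.
apply: (sub_finite_set _ (sym_comm s)) => y [[[n Nn <-] Ny]|[Ny sy]].
  move: Ny; rewrite /restrict_sym; case: asboolP => [_ Ny|//].
  by left; split; [exists n|].
right; split=> // -[n Nn nE]; apply: sy.
have [Yy|Yy] := pselect (Y (t y x)).
  by exists n => //; rewrite /restrict_sym asboolT// -iset_sym nE.
by exists y => //; rewrite /restrict_sym asboolF.
Qed.

Definition restrict_perm : symZN :=
  SymZN restrict_symK restrict_symVK restrict_sym_comm.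

Lemma restrict_perm_in n : Y (t n x) -> restrict_perm n = s n.
Proof. by move=> Yn; rewrite /= /restrict_sym asboolT. Qed.

Lemma restrict_perm_out n : ~ Y (t n x) -> restrict_perm n = n.
Proof. by move=> Yn; rewrite /= /restrict_sym asboolF. Qed.

Lemma restrict_perm_acts :
  (forall n, aut_map restriction (t n x) = restrict_fun f (t n x)) ->
  acts_as T restriction x restrict_perm.
Proof.
move=> E n; rewrite E; have [Yn|Yn] := pselect (Y (t n x)).
  by rewrite restrict_in// restrict_perm_in.
by rewrite restrict_out// restrict_perm_out.
Qed.

(** The points on which s and its restriction differ do not cross 0 under either of
    the two permutations. *)
Lemma restrict_perm_image :
  (forall n, (natZ n <-> natZ (s n)) \/ Y (t n x)) ->
  s @` natZ = restrict_perm @` natZ.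
Proof.
move=> cross; apply/seteqP; split => _ [n Nn <-].
  have [Yn|Yn] := pselect (Y (t n x)).
    by exists n => //; rewrite restrict_perm_in.
  have Ysn : ~ Y (t (s n) x) by rewrite iset_sym.
  exists (s n); last by rewrite restrict_perm_out.
  by have [[+ _]//|//] := cross n; exact.
have [Yn|Yn] := pselect (Y (t n x)).
  by exists n => //; rewrite restrict_perm_in.
rewrite restrict_perm_out//; exists (sym_inv s n); last exact: sym_invK.
have Ysn : ~ Y (t (sym_inv s n) x) by rewrite iset_symV.
have [[_]|//] := cross (sym_inv s n); rewrite sym_invK; exact.
Qed.

End restricted_permutation.

Lemma restriction_com : com_full_group T S -> com_full_group T restriction.
Proof.
move=> /(com_full_groupP X_sep T_free) GS; apply/com_full_groupP => //.
apply: filterS2 GS (ae_iter T restrictionE) => x [s Ss] E.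
by exists (restrict_perm Ss); exact: restrict_perm_acts.
Qed.

End restriction.

(** A commensurating permutation moves only finitely many integers across 0.
    Hence, on a given orbit, Y n eventually contains a fixed window and all the
    points that cross the origin. *)
Lemma restriction_limit (C : set (aut_com T)) S (Y : nat -> invariant_set S) :
  closed C -> com_full_group T S -> (forall n, C (restriction (Y n))) ->
  (forall m n x, (m <= n)%N -> Y m x -> Y n x) ->
  {ae mu, forall x, exists n, Y n x} -> C S.
Proof.
move=> cC GS CY incY covY; apply: (closed_approx cC GS) => m e e0.
have [TS _] := GS; pose c := cocycle T S.
pose E (k : nat) : set X := [set x | exists n : int, ~ Y k (t n x) /\
  ~ ((m < absz n)%N /\ (natZ n <-> natZ (n + c (t n x))))].
have mE (k : nat) : measurable (E k).
  apply: measurable_existsc => n; apply: measurable_andP; apply: measurableC.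
    exact: measurable_preimage_iter (measurable_iset _).
  apply: measurable_andP; first exact: measurable_cstP.
  apply: measurable_ifP; first exact: measurable_cstP.
  rewrite (_ : [set x | _] = [set x | exists l, natZ (n + l) /\ c (t n x) = l]).
    apply: measurable_existsc => l; apply: measurable_andP.
      exact: measurable_cstP.
    have mcl : measurable [set x | c x = l].
      exact/measurable_int_fiber/measurable_cocycle.
    exact: measurable_preimage_iter mcl.
  by apply/seteqP; split => x /=; [exists (c (t n x))|move=> [l [+ ->]]].
have GS' := GS; move/(com_full_groupP X_sep T_free) in GS'.
have aS := acts_as_cocycle X_sep TS.
have acts : {ae mu, forall x, exists2 s : symZN, acts_as T S x s &
    forall n, s n = n + c (t n x)}.
  apply: filterS3 GS' T_free aS => x [s Ss] free Cx.
  by exists s => // n; rewrite (acts_as_unique free Ss Cx).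
have dE i j : (i <= j)%N -> E j `<=` E i.
  move=> ij x [n [nY nm]]; exists n; split => // Yi; apply: nY.
  exact: incY ij Yi.
have E0 : {ae mu, forall x, exists i, ~ E i x}.
  apply: filterS2 acts (ae_iter T covY) => x [s Ss sE] cov.
  pose crossing : set int := [set n | ~ ((m < absz n)%N /\ (natZ n <-> natZ (s n)))].
  have fin : finite_set crossing.
    apply: (@sub_finite_set _ _ ([set n | (absz n <= m)%N] `|`
      sym_inv s @` (s @` natZ `+` natZ))).
      move=> n /not_andP[/negP|nn]; first by left; rewrite /= leqNgt.
      right; exists (s n); last exact: sym_funK.
      have [Nn|Nn] := pselect (natZ n).
        by left; split; [exists n|move=> Nsn; apply: nn].
      right; split; first by apply: contrapT => Nsn; apply: nn.
      by move=> [n' Nn' /(can_inj (@sym_funK s)) e']; apply: Nn; rewrite -e'.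
    rewrite finite_setU; split; first exact: finite_window.
    by apply: finite_image; exact: sym_comm.
  have [N NP] : exists N, forall n, crossing n -> Y N (t n x).
    move: fin => /finite_seqP[a ->]; elim: a => [|n a [N NP]].
      by exists 0%N.
    have [N' Yn] := cov n; exists (maxn N N') => n' /=.
    rewrite inE => /predU1P[->|/NP Yn'].
      exact: incY (leq_maxr _ _) Yn.
    exact: incY (leq_maxl _ _) Yn'.
  exists N => -[n [nY nm]]; apply: nY; apply: NP.
  by rewrite /crossing /= sE.
have [k Ek] := decreasing_null_small mE dE E0 e0.
exists (restriction (Y k)); split; [exact: restriction_com|exact: CY|].
exists (E k); split => //.
apply: filterS2 acts (ae_iter T (restrictionE (Y k))) => x [s Ss sE] rE nE.
have inY n : ~ ((m < absz n)%N /\ (natZ n <-> natZ (s n))) -> Y k (t n x).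
  by rewrite sE => nn; apply: contrapT => nY; apply: nE; exists n.
exists s, (restrict_perm (Y k) Ss); split => //.
- exact: restrict_perm_acts.
- move=> n nm; rewrite restrict_perm_in//; apply: inY => -[].
  by rewrite ltnNge nm.
- apply: restrict_perm_image => n.
  have [|nn] := pselect (natZ n <-> natZ (s n)); first by left.
  by right; apply: inY => -[].
Qed.

End limits.

(** ** Exhaustion *)

Section exhaustion.
Context (R : realType) d (X : measurableType d) (mu : probability X R).
Variable T : aut mu.
Hypothesis X_sep : countably_separated X.
Local Notation t := (aut_iter T).
Hypothesis T_free : {ae mu, forall x, forall k l, t k x = t l x -> k = l}.
Variables (N : set (aut mu)) (C : set (aut_com T)).
Hypotheses (N_sub : is_subgroup N) (cC : closed C)
  (NE : N = com_full_group T `&` C).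

Variable S : aut mu.
Local Notation f := (aut_map S).
Implicit Types Y Z W : invariant_set S.

Definition inv_set0 : invariant_set S :=
  @InvariantSet _ _ _ _ S (fun=> False) (@measurable_cstP _ _ False)
    (fun=> iff_refl _).

Lemma measurable_isetU Y Z : measurable [set x | Y x \/ Z x].
Proof. by apply: measurableU; exact: measurable_iset. Qed.

Lemma isetU_inv Y Z x : Y (f x) \/ Z (f x) <-> Y x \/ Z x.
Proof. by rewrite !iset_inv. Qed.

Definition inv_setU Y Z := InvariantSet (measurable_isetU Y Z) (isetU_inv Y Z).

Lemma measurable_isetC_bigcup (Y : nat -> invariant_set S) :
  measurable [set x | forall n, ~ Y n x].
Proof.
by apply: measurable_forallc => n; exact/measurableC/measurable_iset.
Qed.

Lemma isetC_bigcup_inv (Y : nat -> invariant_set S) x :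
  (forall n, ~ Y n (f x)) <-> (forall n, ~ Y n x).
Proof. by split=> nY n Yn; apply: (nY n); apply/iset_inv. Qed.

Definition inv_setC_bigcup (Y : nat -> invariant_set S) :=
  InvariantSet (measurable_isetC_bigcup Y) (isetC_bigcup_inv Y).

Lemma restriction0 : restriction inv_set0 = 1%g.
Proof. by apply: aut_class_eq => x /=; rewrite restrict_out. Qed.

Lemma restrictionU Y Z : (forall x, Y x -> ~ Z x) ->
  restriction (inv_setU Y Z) = (restriction Y * restriction Z)%g.
Proof.
move=> YZ; rewrite -[RHS]aut_class_mul; apply: aut_class_eq => x /=.
have [Zx|Zx] := pselect (Z x).
  rewrite (restrict_in (Y := Z))// (restrict_out (Y := Y)).
    by rewrite restrict_in//=; right.
  by move=> /YZ; apply; rewrite iset_inv.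
rewrite (restrict_out (Y := Z))//; have [Yx|Yx] := pselect (Y x).
  by rewrite !restrict_in//=; left.
by rewrite !restrict_out//= => -[].
Qed.

Lemma greedy_step Y : exists Z, [/\ N (restriction Z), (forall x, Y x -> ~ Z x) &
  forall W, N (restriction W) -> (forall x, Y x -> ~ W x) ->
    fine (mu [set x | W x]) <= 2 * fine (mu [set x | Z x])].
Proof.
pose A := [set r : R | exists Z, [/\ N (restriction Z), (forall x, Y x -> ~ Z x) &
  r = fine (mu [set x | Z x])]].
have A0 : A 0.
  exists inv_set0; split; [by rewrite restriction0; exact: (subgroup1 N_sub)|by move=> x _ []|].
  exact: (congr1 fine (esym (measure0 mu))).
have ubA : has_ubound A.
  exists 1 => _ [Z [_ _ ->]].
  have mZ := measurable_iset Z.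
  rewrite -lee_fin fineK ?fin_num_measure//; exact: probability_le1.
have supA : has_sup A by split; first by exists 0.
have [A_le0|A_gt0] := leP (sup A) 0.
  exists inv_set0; split; [by rewrite restriction0; exact: (subgroup1 N_sub)|by move=> x _ []|].
  move=> W NW YW; apply: (@le_trans _ _ 0).
    by apply: le_trans A_le0; apply: ub_le_sup => //; exists W.
  by rewrite mulr_ge0// fine_ge0.
have [|_ [Z [NZ YZ ->]] Zsup] := sup_adherent (eps := sup A / 2) _ supA.
  by rewrite divr_gt0.
exists Z; split => // W NW YW; apply: (@le_trans _ _ (sup A)).
  by apply: ub_le_sup => //; exists W.
move: Zsup; rewrite {1}(splitr (sup A)) addrK => /ltW.
by rewrite ler_pdivrMr// mulrC.
Qed.

Hypothesis GS : com_full_group T S.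

(** Greedily collect disjoint invariant sets, each of measure at least half the
    best possible: since the total measure is finite, nothing of positive measure
    is left over. *)
Lemma exhaustion :
  (forall Z, (0 < mu [set x | Z x])%E -> exists Y, [/\ (forall x, Y x -> Z x),
    (0 < mu [set x | Y x])%E & N (restriction Y)]) -> N S.
Proof.
move=> dense; have [step stepP] := choice greedy_step.
pose Y n := iter n (fun Y => inv_setU Y (step Y)) inv_set0.
have NY n : N (restriction (Y n)).
  elim: n => [|n IH]; first by rewrite restriction0; exact: (subgroup1 N_sub).
  rewrite /= restrictionU; first by apply: (subgroupM N_sub) => //; have [] := stepP (Y n).
  by have [] := stepP (Y n).
have incY m n x : (m <= n)%N -> Y m x -> Y n x.
  by move=> /subnK <-; elim: (n - m)%N => // k IH Ym; left; exact: IH.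
have mY n : measurable [set x | Y n x] by exact: measurable_iset.
pose Z := inv_setC_bigcup Y.
have Z0 : mu [set x | Z x] = 0%E.
  apply: contrapT => /mu_gt0P /dense[W [WZ /mu_gt0P W0 NW]]; apply: W0.
  have mW : measurable [set x | W x] by exact: measurable_iset.
  have bound n : fine (mu [set x | W x]) * n%:R <= 2 * fine (mu [set x | Y n x]).
    elim: n => [|n IH]; first by rewrite mulr0 mulr_ge0// fine_ge0.
    have [_ YZ Zmax] := stepP (Y n).
    have mst : measurable [set x | step (Y n) x] by exact: measurable_iset.
    rewrite (_ : [set x | Y n.+1 x] = [set x | Y n x] `|` [set x | step (Y n) x])//.
    rewrite measureU//; last by apply/seteqP; split => x // -[] /YZ.
    rewrite fineD ?fin_num_measure// mulrDr -natr1 mulrDr mulr1 lerD//.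
    by apply: Zmax => // x Yx /WZ /(_ n).
  suff W0 : fine (mu [set x | W x]) = 0.
    exact: (etrans (esym (fineK (fin_num_measure mu _ mW))) (congr1 EFin W0)).
  apply/eqP; rewrite eq_le fine_ge0// andbT leNgt; apply/negP => W0.
  have [n nW] : exists n : nat, 2 / fine (mu [set x | W x]) < n%:R.
    by exists (Num.bound (2 / fine (mu [set x | W x]))); rewrite archi_boundP// divr_ge0// ltW.
  have := bound n; rewrite leNgt => /negP; apply.
  rewrite ltr_pdivrMr// mulrC in nW; apply: le_lt_trans nW.
  rewrite -[leRHS]mulr1 ler_pM2l// -lee_fin fineK ?fin_num_measure//.
  exact: probability_le1.
rewrite NE; split => //.
apply: (restriction_limit X_sep T_free cC GS _ incY) => [n|].
  by have := NY n; rewrite NE => -[].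
have /(ae_not (measurable_iset Z)) := Z0; apply: filterS => x nZ.
by apply: contrapT => nY; apply: nZ => n Yn; apply: nY; exists n.
Qed.

End exhaustion.

(** * A nontrivial normal subgroup contains small permutations of levels *)

Section alternating_groups.
Variable I : finType.
Implicit Types (s : {perm I}) (Q : {perm I} -> Prop).

Lemma Alt_sub_normal Q : (4 < #|I|)%N ->
  Q 1%g -> (forall s s', Q s -> Q s' -> Q (s / s')%g) ->
  (forall s s', Q s -> s' \in ('Alt_I)%g -> Q (s ^ s')%g) ->
  (exists s, [/\ s \in ('Alt_I)%g, Q s & s <> 1%g]) ->
  forall s, s \in ('Alt_I)%g -> Q s.
Proof.
move=> I5 Q1 Qd QJ [s0 [As0 Qs0 s01]] s As.
pose K := [set s in ('Alt_I)%g | `[< Q s >]]%SET.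
have KP u : reflect (u \in ('Alt_I)%g /\ Q u) (u \in K).
  by rewrite /K [X in reflect _ X]finset.in_set; apply: (iffP andP) => -[Au /asboolP].
have Kg : group_set K.
  apply/group_setP; split; first by apply/KP; rewrite group1.
  move=> u v /KP[Au Qu] /KP[Av Qv]; apply/KP; rewrite groupM//; split => //.
  have QV : Q v^-1%g by rewrite -[v^-1%g]mul1g; exact: Qd.
  by rewrite -[v]invgK; exact: Qd.
have /simpleP[_ /(_ (Group Kg))[]] := simple_Alt5 I5.
- apply/andP; split; first by apply/fintype.subsetP => u /KP[].
  apply/normsP => v Av; apply/setP => u; rewrite mem_conjg.
  apply/KP/KP => -[Au Qu].
    split; last by rewrite -[u](conjgKV v); exact: QJ.
    by rewrite -[u](conjgKV v) groupJ.
  by split; [rewrite groupJ ?groupV|apply: QJ; rewrite ?groupV].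
- move=> K1; have s0K : s0 \in Group Kg by apply/KP.
  by move: s0K; rewrite K1 => /set1P.
- by move=> KA; move: As; rewrite -KA => /KP[].
Qed.

Lemma ex_noncommuting_even (p1 p2 p3 p4 : I) : uniq [:: p1; p2; p3; p4] ->
  exists h k : {perm I}, [/\ h \in ('Alt_I)%g, k \in ('Alt_I)%g, [~ h, k]%g <> 1%g &
    forall q, q \notin [:: p1; p2; p3; p4] -> h q = q /\ k q = q].
Proof.
rewrite /= !inE !negb_or => /and4P[/and3P[n12 n13 n14] /andP[n23 n24] n34 _].
exists (tperm p1 p2 * tperm p1 p3)%g, (tperm p1 p2 * tperm p1 p4)%g; split.
- by rewrite Alt_even odd_permM !odd_tperm n12 n13.
- by rewrite Alt_even odd_permM !odd_tperm n12 n14.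
- have t13 : tperm p1 p3 p2 = p2 by rewrite tpermD// eq_sym.
  have t14 : tperm p1 p4 p2 = p2 by rewrite tpermD// eq_sym.
  move=> /eqP/commgP/permP/(_ p1); rewrite !permM !tpermL t13 t14 tpermR !tpermL.
  by move=> e; rewrite e eqxx in n34.
- move=> q; rewrite !inE !negb_or => /and4P[q1 q2 q3 q4].
  by rewrite !permM !tpermD// eq_sym.
Qed.

End alternating_groups.

Section commutators.
Context (R : realType) d (X : measurableType d) (mu : probability X R).
Implicit Types (S : aut mu) (A : set X) (P : X -> Prop).

Definition supported_in S P := {ae mu, forall x, ~ P x -> aut_map S x = x}.

Lemma supported_inV S P : supported_in S P -> supported_in S^-1%g P.
Proof.
rewrite /supported_in => SP; apply: filterS2 SP (aut_invE S) => x Sx SVx nP.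
by rewrite SVx -{1}(Sx nP) ns_funK.
Qed.

Lemma disjoint_support_commute S S' P P' : supported_in S P -> supported_in S' P' ->
  {ae mu, forall x, P x -> ~ P' x} -> (S * S')%g = (S' * S)%g.
Proof.
rewrite /supported_in => SP SP' PP'; apply/aut_eqP.
have E := ae_andP (aut_mulE S S') (aut_mulE S' S).
have ae3 : {ae mu, forall x, [/\ ~ P x -> aut_map S x = x,
    ~ P' x -> aut_map S' x = x & P x -> ~ P' x]}.
  by apply: filterS3 SP SP' PP' => x.
have aeS := ae_andP (ae_preimage_ns (aut_map S) ae3)
  (ae_preimage_ns (aut_map S') ae3).
apply: filterS3 E ae3 aeS => x [-> ->] [Sx S'x PP'x] [[Sy S'y PP'y] [Sz S'z PP'z]].
have [Px|Px] := pselect (P x).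
  rewrite (S'x (PP'x Px)); have [Py|Py] := pselect (P' (aut_map S x)).
    have nPy : ~ P (aut_map S x) by move=> /PP'y.
    by move: (Sy nPy) Py => /aut_map_inj -> /(PP'x Px).
  by rewrite S'y.
rewrite (Sx Px); have [Pz|Pz] := pselect (P (aut_map S' x)).
  by move: (S'z (PP'z Pz)) (Pz) => /aut_map_inj ->.
by rewrite Sz.
Qed.

End commutators.

Section derived_subgroups.
Variables (G : groupType) (H : set G).

Lemma derived_subgroup_commg x y : H x -> H y -> derived_subgroup H [~ x, y]%g.
Proof. by move=> Hx Hy; apply: sub_gen_smallest; exists x => //; exists y. Qed.

Lemma derived_is_subgroup : is_subgroup (derived_subgroup H).
Proof.
split=> [K [[K1 _] _]//|x y Dx Dy K Ksub].
by have [[_ Kd] _] := Ksub; apply: Kd; [exact: Dx|exact: Dy].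
Qed.

End derived_subgroups.

Section commutator_trick.
Context (R : realType) d (X : measurableType d) (mu : probability X R).
Variable T : aut mu.
Hypothesis X_sep : countably_separated X.
Local Notation t := (aut_iter T).
Hypothesis T_free : {ae mu, forall x, forall k l, t k x = t l x -> k = l}.
Variables (N H : set (aut mu)).
Hypotheses (N_sub : is_subgroup N)
  (N_norm : forall x y, N x -> H y -> N (x ^ y)%g).

(** If g moves A off itself, then h^-1 conjugated by g commutes with every k
    supported in A, and [g, h] = (h^-1)^g h has the same commutator with k as h. *)
Lemma commutator_trick (A : set X) (g h k : aut mu) : N g -> H h -> H k ->
  {ae mu, forall x, A x -> ~ A (aut_map g x)} ->
  supported_in h A -> supported_in k A -> N [~ h, k]%g.
Proof.
move=> Ng Hh Hk gA hA kA; pose u := (h^-1 ^ g)%g.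
have uA : supported_in u (fun x => A (aut_map g x)).
  rewrite /supported_in.
  have hg : {ae mu, forall x, ~ A (aut_map g x) ->
      aut_map h^-1%g (aut_map g x) = aut_map g x}.
    exact: (ae_preimage_ns (aut_map g) (supported_inV hA)).
  have E1 : {ae mu, forall x, aut_map g^-1%g (aut_map (h^-1 * g)%g x) = aut_map u x}.
    by apply: filterS (aut_mulE g^-1%g (h^-1 * g)%g) => x ->.
  have E2 := ae_andP (aut_mulE h^-1%g g) (ae_preimage_ns (aut_map g) (aut_invE g)).
  apply: filterS3 hg E1 E2 => x hx <- [-> gV] nA.
  by rewrite (hx nA) gV ns_funK.
have uk : (u * k)%g = (k * u)%g.
  apply: (disjoint_support_commute uA kA).
  by apply: filterS gA => x gA Ax /gA.
have Nuh : N (u * h)%g.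
  have -> : (u * h = g^-1 * g ^ h)%g by rewrite /u /conjg !mulgA.
  by apply: (subgroupM N_sub); [exact: (subgroupV N_sub)|exact: N_norm].
move: u uA uk Nuh => u _ uk Nuh.
have -> : [~ h, k]%g = ((u * h)^-1 * (u * h) ^ k)%g.
  rewrite /commg /conjg invMg -!mulgA; congr (_ * _)%g.
  have kVu : (k^-1 * u = u * k^-1)%g.
    by apply: (@mulgI _ k); rewrite mulgA mulgV mul1g mulgA -uk -mulgA mulgV mulg1.
  by rewrite (mulgA k^-1%g u) kVu -mulgA mulKg.
by apply: (subgroupM N_sub); [exact: (subgroupV N_sub)|exact: N_norm].
Qed.

(** The points moved by g are covered by the sets of the points that some member of
    the separating family distinguishes from their image. *)
Lemma ex_displaced_set (g : aut mu) : g <> 1%g -> exists A,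
  [/\ measurable A, (0 < mu A)%E & forall x, A x -> ~ A (aut_map g x)].
Proof.
move=> g1; have [D [mD sepD]] := X_sep.
have mg : measurable [set x | aut_map g x = x].
  by apply: measurable_eqfun => //; exact: measurable_ns_fun.
pose P (c : nat * bool) x := (D c.1 x <-> c.2) /\ (D c.1 (aut_map g x) <-> ~~ c.2).
have mP c : measurable [set x | P c x].
  by apply: measurable_andP; apply: measurable_ifP; do ?[exact: measurable_cstP
    |exact: measurable_preimage_ns|exact: mD].
have g0 : (0 < mu (~` [set x | aut_map g x = x]))%E.
  apply/mu_gt0P => /(ae_not (measurableC mg)) gx; apply: g1; apply/aut_eqP.
  apply: filterS2 gx (aut_oneE mu) => x gx ->; exact: contrapT.
have [|c Pc0] := pos_ae_split (measurableC mg) g0 mP.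
  apply: aeW => x gx; apply: contrapT => nP; apply: gx; apply: sepD => n.
  split=> Dn; apply: contrapT => nDn.
    by apply: nP; exists (n, false); split; split.
  by apply: nP; exists (n, true); split; split.
exists (~` [set x | aut_map g x = x] `&` [set x | P c x]); split => //.
  by apply: measurableI => //; exact: measurableC.
move=> x [_ [_ gx]] [_ [gx' _]].
by case: (c.2) gx gx' => -[a a'] [b b']; [have := a (b' isT)|have := b (a' isT)].
Qed.

Variable (I : finType).

Lemma tower_permR (P : tower T I) (s s' : {perm I}) :
  tower_perm P [~ s, s']%g = [~ tower_perm P s, tower_perm P s']%g.
Proof. by rewrite /commg /conjg !tower_permM !tower_permV. Qed.

(** The permutations sent into D(G) form a subgroup that is normal, because
    s1 ^ s2 = s1 [s1, s2], and not trivial. *)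
Lemma tower_perm_Alt_derived (P : tower T I) (s : {perm I}) : (4 < #|I|)%N ->
  s \in ('Alt_I)%g -> derived_subgroup (com_full_group T) (tower_perm P s).
Proof.
move=> I5; have [D1 Dd] := derived_is_subgroup (com_full_group T).
apply: (Alt_sub_normal (Q := fun s => derived_subgroup (com_full_group T) (tower_perm P s))) => //.
- by rewrite tower_perm1.
- by move=> s1 s2 D_1 D_2; rewrite tower_permM tower_permV; exact: Dd.
- move=> s1 s2 D_1 _.
  rewrite (_ : s1 ^ s2 = s1 * [~ s1, s2])%g; last by rewrite /commg mulKVg.
  rewrite tower_permM tower_permR; apply: (subgroupM (derived_is_subgroup _)) => //.
  by apply: derived_subgroup_commg; exact: tower_perm_com.
have [f fi] : exists f : 'I_4 -> I, injective f.
  exists (fun i => enum_val (widen_ord (ltnW I5) i)).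
  by move=> i j /enum_val_inj/(congr1 val)/= ?; exact: val_inj.
have [|h [k [Ah Ak hk _]]] :=
  @ex_noncommuting_even I (f (inord 0)) (f (inord 1)) (f (inord 2)) (f (inord 3)).
  by rewrite /= !inE !(inj_eq fi) -!val_eqE/= !inordK.
exists [~ h, k]%g; split => //; first by rewrite groupR.
by rewrite tower_permR; apply: derived_subgroup_commg; exact: tower_perm_com.
Qed.

End commutator_trick.

(** The letters are two copies of I, exchanged by a swap, and five spare ones: four
    of them carry the commutator trick, and with five the alternating group is
    simple even when I is empty. *)
Section doubled_permutations.
Variable I : finType.
Local Notation J := (I * bool + 'I_5)%type.
Implicit Types (u v : bool -> {perm I}) (s : {perm I}).

Definition copies_fun u (x : J) : J :=
  match x with inl (i, b) => inl (u b i, b) | inr j => inr j end.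

Lemma copies_funK u : cancel (copies_fun u) (copies_fun (fun b => (u b)^-1%g)).
Proof. by case=> [[i b]|j] //=; rewrite permK. Qed.

Definition copies u : {perm J} := perm (can_inj (copies_funK u)).

Definition double s : {perm J} := copies (fun=> s).

Definition swap_fun (x : J) : J :=
  match x with inl (i, b) => inl (i, ~~ b) | inr j => inr j end.

Lemma swap_funK : involutive swap_fun.
Proof. by case=> [[i b]|j] //=; rewrite negbK. Qed.

(** The actions of s on the two copies of I are conjugate by the swap, so they have
    the same parity. *)
Lemma double_even s : double s \in ('Alt_J)%g.
Proof.
pose w : {perm J} := perm (can_inj swap_funK).
pose u (b : bool) := if b then 1%g else s.
have -> : double s = (copies u * copies u ^ w)%g.
  apply/permP => x; rewrite permM /conjg !permM.
  have wE y : w y = swap_fun y by rewrite permE.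
  have wV y : w^-1%g y = swap_fun y.
    by apply: (@perm_inj _ w); rewrite permKV wE swap_funK.
  rewrite wE wV !permE.
  by case: x => [[i [|]]|j] //=; rewrite ?permE/= ?perm1.
by rewrite Alt_even odd_permM odd_permJ addbb.
Qed.

End doubled_permutations.

Section local_lemma.
Context (R : realType) d (X : measurableType d) (mu : probability X R).
Variable T : aut mu.
Hypothesis X_sep : countably_separated X.
Hypotheses (mu_atomless : atomless mu) (T_ergodic : ergodic T).
Local Notation t := (aut_iter T).
Implicit Types (A B C : set X).

Let T_free := aperiodic X_sep mu_atomless T_ergodic.

(** Iterating recurrence, each visit being later than the previous ones. *)
Lemma ex_common_visits A C (n : nat) (M : int) :
  measurable A -> (0 < mu A)%E -> measurable C -> (0 < mu C)%E ->
  exists ls : seq int, [/\ size ls = n, uniq ls, {in ls, forall l, M < l},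
    measurable [set x | C x /\ forall l, l \in ls -> A (t l x)] &
    (0 < mu [set x | C x /\ forall l, l \in ls -> A (t l x)])%E].
Proof.
move=> mA A0; elim: n C M => [|n IH] C M mC C0.
  exists [::]; rewrite (_ : [set x | _] = C)//.
  by apply/seteqP; split => x /=; [case|split].
have mP (k : int) : measurable [set x | M < k /\ A (t k x)].
  by apply: measurable_andP; [exact: measurable_cstP|exact: measurable_preimage_iter].
have rec := recurrence mu_atomless T_ergodic true M mA A0.
have [|l Cl0] := pos_ae_split mC C0 mP; first by apply: filterS rec.
have Ml : M < l.
  by have [x [_ []]] := pos_nonempty (measurableI _ _ mC (mP l)) Cl0.
have [ls [sz uls Ml' mls ls0]] := IH _ l (measurableI _ _ mC (mP l)) Cl0.
exists (l :: ls).
have E : [set x | C x /\ forall k, k \in l :: ls -> A (t k x)] =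
    [set x | (C `&` [set x | M < l /\ A (t l x)]) x /\ forall k, k \in ls -> A (t k x)].
  apply/seteqP; split => x /= [Cx Ax]; split.
  - by split => //; split => //; apply: Ax; rewrite inE eqxx.
  - by move=> k kls; apply: Ax; rewrite inE kls orbT.
  - by case: Cx.
  - by move=> k; rewrite inE => /predU1P[->|/Ax//]; case: Cx => _ [].
rewrite E; split => //=; first by rewrite sz.
  by rewrite uls andbT; apply/negP => /Ml'; rewrite ltxx.
by move=> k; rewrite inE => /predU1P[->//|/Ml']; exact: lt_trans.
Qed.

Definition subtower (I : finType) (P : tower T I) B (mB : measurable B)
    (BP : B `<=` tbase P) : tower T I :=
  Tower mB (disjoint_translatesS BP (@theight_disjoint _ _ _ _ _ _ P)).

Variables (N H : set (aut mu)).
Hypotheses (N_sub : is_subgroup N)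
  (N_norm : forall x y, N x -> H y -> N (x ^ y)%g)
  (DH : derived_subgroup (com_full_group T) `<=` H)
  (N_nontrivial : exists2 g, N g & g <> 1%g).

(** The tower is restricted to two translates of a small set, so that s becomes
    the even permutation double s; the spare letters are translates taken inside a
    set A that some element of N displaces. The commutator trick yields a
    nontrivial even permutation of the levels in N, and the alternating group of
    the levels is simple. *)
Lemma local_tower_perm (I : finType) (P : tower T I) (s : {perm I}) :
  (0 < mu (tbase P))%E ->
  exists B (mB : measurable B) (BP : B `<=` tbase P),
    (0 < mu B)%E /\ N (tower_perm (subtower mB BP) s).
Proof.
move=> P0; have [g Ng g1] := N_nontrivial.
have [A [mA A0 gA]] := ex_displaced_set X_sep g1.
have mP := measurable_tbase P.
pose h := theight P.
have hinj : injective h.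
  have [x Px] := pos_nonempty mP P0.
  by move=> i j ij; apply: (theight_disjoint Px Px); rewrite -/h ij.
pose K : int := \sum_i `|h i|.
have hK i : - K <= h i <= K.
  by rewrite -ler_norml /K (bigD1 i)//= lerDl sumr_ge0.
have K0 : 0 <= K by apply: sumr_ge0.
have [[|m [|? ?]] [] // _ _ Mm mC1 C10] := ex_common_visits 1 (K + K) mP P0 mP P0.
have {}Mm : K + K < m by apply: Mm; rewrite inE.
have [ls [sz uls Mls mC2 C20]] := ex_common_visits 5 (K + m) mA A0 mC1 C10.
pose l (j : 'I_5) : int := nth 0 ls j.
(* K bounds the heights, m > 2 K and the times in ls exceed K + m, so that all the
   levels have distinct heights *)
pose kappa (x : I * bool + 'I_5) :=
  match x with inl (i, b) => h i + (if b then m else 0) | inr j => l j end.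
have lsP (j : 'I_5) : K + m < l j by apply: Mls; rewrite mem_nth ?sz.
have kinj : injective kappa.
  move=> [[i b]|j] [[i' b']|j'] /= e.
  - have := hK i; have := hK i'; move: e; case: b; case: b' => e hi hi';
      try (exfalso; lia); by rewrite (hinj i i')//; lia.
  - by exfalso; have := lsP j'; have := hK i; move: e; case: b; lia.
  - by exfalso; have := lsP j; have := hK i'; move: e; case: b'; lia.
  - by congr inr; apply/val_inj/eqP; rewrite -(nth_uniq 0 _ _ uls) ?sz ?ltn_ord//; apply/eqP; exact: e.
have [B [mB BC B0 dB]] := ex_tower X_sep mu_atomless T_ergodic kinj mC2 C20.
(* Q is the big tower; its base together with the translate of it by m will be the
   base of the required tower *)
pose Q := Tower mB dB.
have BP x : B x -> tbase P x by move=> /BC[[]].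
have BmP x : B x -> tbase P (t m x) by move=> /BC[[_ Pm] _]; apply: Pm; rewrite inE.
have BA x (j : 'I_5) : B x -> A (t (l j) x).
  by move=> /BC[_]; apply; rewrite mem_nth ?sz.
have J5 : (4 < #|{: I * bool + 'I_5}|)%N.
  by rewrite card_sum card_ord leq_addl.
have supp (u : {perm I * bool + 'I_5}) :
    (forall p, u (inl p) = inl p) -> supported_in (tower_perm Q u) A.
  move=> uP; apply: filterS (tower_permE Q u) => x -> nA.
  have [[[p|j] /levelP[b Bb xE]]|nL] := pselect (exists i, level Q i x).
  - rewrite xE tower_fun_level// (_ : u^-1%g (inl p) = inl p)//.
    by apply: (@perm_inj _ u); rewrite permKV uP.
  - by case: nA; rewrite xE; exact: BA.
  - by apply: tower_fun_off => i Li; apply: nL; exists i.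
have NAlt : forall u, u \in ('Alt_(I * bool + 'I_5)%type)%g -> N (tower_perm Q u).
  apply: (Alt_sub_normal (Q := fun u => N (tower_perm Q u))) => //.
  - by rewrite tower_perm1; exact: (subgroup1 N_sub).
  - move=> u v Nu Nv; rewrite tower_permM tower_permV.
    by apply: (subgroupM N_sub) => //; exact: (subgroupV N_sub).
  - move=> u v Nu Av; rewrite /conjg !tower_permM tower_permV.
    by apply: N_norm => //; apply: DH; exact: tower_perm_Alt_derived.
  have [|u [v [Au Av uv fixed]]] := @ex_noncommuting_even (I * bool + 'I_5)%type
    (inr (inord 0)) (inr (inord 1)) (inr (inord 2)) (inr (inord 3)).
    rewrite -[X in uniq X]/(map inr [:: inord 0; inord 1; inord 2; inord 3]).
    rewrite map_inj_uniq => [|? ? []//].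
    by rewrite -(map_inj_uniq val_inj) /= !inordK.
  exists [~ u, v]%g; split => //; first by rewrite groupR.
  rewrite tower_permR; apply: (commutator_trick N_sub N_norm Ng (A := A)).
  - by apply: DH; exact: tower_perm_Alt_derived.
  - by apply: DH; exact: tower_perm_Alt_derived.
  - exact: aeW.
  - by apply: supp => p; have [] := fixed (inl p) isT.
  - by apply: supp => p; have [] := fixed (inl p) isT.
pose B2 : set X := [set x | B x \/ B (t (- m) x)].
have mB2 : measurable B2.
  by apply: measurableU => //; exact: measurable_preimage_iter mB.
have B2P : B2 `<=` tbase P.
  by move=> x [/BP//|/BmP]; rewrite aut_iterVK.
exists B2, mB2, B2P; split.
  by apply: (pos_ae_sub mB mB2 B0 _); apply: aeW => x Bx; left.
have tower_funE u x : tower_fun (subtower mB2 B2P) u x = tower_fun Q (double u) x.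
  have [[i /levelP[b Bb ->]]|nL] := pselect (exists i, level (subtower mB2 B2P) i x).
    rewrite tower_fun_level//; case: Bb => Bb.
      have E (j : I) : theight (subtower mB2 B2P) j = theight Q (inl (j, false)).
        by rewrite /= addr0.
      by rewrite !E tower_fun_level// permE.
    have E (j : I) : t (theight (subtower mB2 B2P) j) b =
        t (theight Q (inl (j, true))) (t (- m) b).
      by rewrite -aut_iterD /= addrK.
    by rewrite !E tower_fun_level// permE.
  rewrite tower_fun_off; last by move=> i Li; apply: nL; exists i.
  have [[[[i b]|j] /levelP[y By xE]]|nQ] := pselect (exists i, level Q i x).
  - exfalso; apply: nL; exists i; apply/levelP; move: xE; rewrite /=.
    case: b => xE; [exists (t m y)|exists y]; rewrite ?xE -?aut_iterD ?addr0//.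
      by right; rewrite /= aut_iterK.
    by left.
  - by rewrite xE tower_fun_level// permE.
  - by rewrite tower_fun_off// => i Li; apply: nQ; exists i.
have -> : tower_perm (subtower mB2 B2P) s = tower_perm Q (double s^-1)^-1%g.
  by apply: aut_class_eq => x /=; rewrite invgK tower_funE.
by apply: NAlt; rewrite groupV; exact: double_even.
Qed.

End local_lemma.

(** * Periodic elements *)

Section periodic_elements.
Context (R : realType) d (X : measurableType d) (mu : probability X R).
Variable T : aut mu.
Hypothesis X_sep : countably_separated X.
Hypotheses (mu_atomless : atomless mu) (T_ergodic : ergodic T).
Local Notation t := (aut_iter T).

Let T_free := aperiodic X_sep mu_atomless T_ergodic.

Variables (N H : set (aut mu)) (C : set (aut_com T)).
Hypotheses (N_sub : is_subgroup N) (cC : closed C)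
  (NE : N = com_full_group T `&` C)
  (N_norm : forall x y, N x -> H y -> N (x ^ y)%g)
  (DH : derived_subgroup (com_full_group T) `<=` H)
  (N_nontrivial : exists2 g, N g & g <> 1%g).

Lemma measurable_iter (f : X -> X) (n : nat) : measurable_fun [set: X] f ->
  measurable_fun [set: X] (iter n f).
Proof.
move=> mf; elim: n => [|n IH]; first exact: measurable_id.
exact: (measurableT_comp mf IH).
Qed.

(** On a suitable set of positive measure the S-orbits have constant length and
    a constant pattern inside the T-orbits; there S permutes the levels of a tower
    cyclically. *)
Lemma periodic_in_normal S : com_full_group T S ->
  {ae mu, forall x, exists l : nat, iter l.+1 (aut_map S) x = x} -> N S.
Proof.
move=> GS per; set f := aut_map S; have finj : injective f := @aut_map_inj _ _ _ _ S.
apply: (exhaustion X_sep T_free N_sub cC NE GS) => Z Z0.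
have mZ := measurable_iset Z.
have mf n : measurable_fun [set: X] (iter n f).
  by apply: measurable_iter; exact: measurable_ns_fun.
have fZ (n : nat) x : Z x -> Z (iter n f x).
  by move=> Zx; elim: n => //= n IH; apply/iset_inv.
have iterD m n x : iter (m + n) f x = iter m f (iter n f x) by rewrite iterD.
have iterinj n : injective (iter n f).
  by elim: n => // n IH x y /= /finj /IH.
pose minper (l : nat) x := iter l.+1 f x = x /\
  forall i : nat, (0 < i <= l)%N -> iter i f x <> x.
have mminper l : measurable [set x | minper l x].
  apply: measurable_andP; last apply: measurable_forallc => i; last apply: measurable_imply.
  - by apply: measurable_eqfun => //; exact: measurable_id.
  - exact: measurable_cstP.
  - by apply: measurableC; apply: measurable_eqfun => //; exact: measurable_id.
have [|l Zl0] := pos_ae_split mZ Z0 mminper.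
  apply: filterS per => x exl _.
  have {}exl : exists l : nat, `[< iter l.+1 f x = x >].
    by case: exl => l; exists l; exact/asboolP.
  case/ex_minnP: exl => l /asboolP fl lmin; exists l; split => // -[//|i] /andP[_ il] fi.
  by have := lmin i (asboolT fi); rewrite leqNgt il.
have mZl := measurableI _ _ mZ (mminper l).
pose pattern (k : {ffun 'I_l.+1 -> int}) x := forall i : 'I_l.+1, iter i f x = t (k i) x.
have mpattern k : measurable [set x | pattern k x].
  by apply: measurable_forallc => i; apply: measurable_eqfun => //; exact: measurable_aut_iter.
have [|k Zk0] := pos_ae_split mZl Zl0 mpattern.
  have [TS _] := GS; apply: filterS (ae_iter T TS) => x Sx _.
  have /choice[k kP] : forall i : 'I_l.+1, exists k, iter i f x = t k x.
    move=> i; elim: (nat_of_ord i) => [|n [k kn]]; first by exists 0.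
    by have [k' Sk] := Sx k; exists (k' + k); rewrite /= kn Sk aut_iterD.
  by exists [ffun i => k i] => i; rewrite ffunE.
have mZk := measurableI _ _ mZl (mpattern k).
have [|D [mD DZ D0 dD]] := ex_disjoint_translates X_sep (T := T) (kappa := k) mZk Zk0.
  apply: aeW => x [[_ [_ xmin]] xk] i j; rewrite -!xk => e.
  have main (a b : 'I_l.+1) : (a < b)%N -> iter a f x <> iter b f x.
    move=> ab; rewrite -(subnKC (ltnW ab)) iterD => /iterinj /esym.
    by apply: xmin; have := ltn_ord b; lia.
  by apply/val_inj; have [/main|/main|] := ltngtP i j; rewrite ?e.
pose Q := Tower mD dD; pose s : {perm 'I_l.+1} := perm (@ordS_inj l.+1).
have [B [mB [BD [B0 NB]]]] := local_tower_perm X_sep mu_atomless T_ergodic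
  N_sub N_norm DH N_nontrivial s^-1 (D0 : (0 < mu (tbase Q))%E).
set QB := subtower mB BD in NB.
have BP x : B x -> [/\ Z x, iter l.+1 f x = x & pattern k x].
  by move=> /BD /DZ[[Zx [fx _]] kx].
have fB i b : B b -> f (t (k i) b) = t (k (s i)) b.
  move=> /BP[_ fb kb]; rewrite -!kb permE /=.
  have [il|il] := ltnP i l; first by rewrite modn_small.
  have -> : (i : nat) = l by apply/eqP; rewrite eqn_leq il -ltnS ltn_ord.
  by rewrite modnn; exact: fb.
have Yinv x : (exists i, level QB i (f x)) <-> (exists i, level QB i x).
  split=> -[i /levelP[b Bb xE]].
    exists (s^-1%g i); apply/levelP; exists b => //; apply: finj.
    by rewrite fB// permKV.
  by exists (s i); apply/levelP; exists b; rewrite // xE; exact: fB.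
have mY : measurable [set x | exists i, level QB i x].
  by apply: measurable_existsc => i; exact: measurable_level.
pose Y : invariant_set S := InvariantSet mY Yinv.
exists Y; split.
- by move=> x [i /levelP[b /BP[Zb _ kb] ->]]; rewrite /= -kb; exact: fZ.
- apply: (pos_ae_sub mB mY B0 _); apply: aeW => x Bx; exists ord0.
  by apply/levelP; exists x => //=; have [_ _ /(_ ord0)] := BP _ Bx.
- have -> : restriction Y = tower_perm QB s^-1%g; last by [].
  apply: aut_class_eq => x /=; rewrite invgK.
  have [Yx|Yx] := pselect (Y x); last first.
    by rewrite restrict_out// tower_fun_off// => i Li; apply: Yx; exists i.
  rewrite restrict_in//; case: Yx => i /levelP[b Bb ->].
  by rewrite tower_fun_level//; exact: fB.
Qed.

End periodic_elements.

(** * Elements of index zero *)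

Section index.
Implicit Types (A B D : set int) (s : symZN).

Definition indicator_diff A B (v : int) : int :=
  (`[< A v >] : nat)%:Z - (`[< B v >] : nat)%:Z.

(** For infinite sets with finite symmetric difference this plays the role of
    #|A| - #|B|. *)
Definition excess A B : int := \sum_(v \in [set: int]) indicator_diff A B v.

Lemma excess_window A B (W : set int) : A `+` B `<=` W ->
  excess A B = \sum_(v \in W) indicator_diff A B v.
Proof.
move=> ABW; apply/esym/fsbig_widen => // v [_ Wv].
apply/eqP; rewrite subr_eq0; apply/eqP; congr (nat_of_bool _)%:Z.
apply/asbool_equiv_eq; split=> ?; apply: contrapT => ?; apply: Wv; apply: ABW;
  by [left|right].
Qed.

Lemma excess_add A B D : finite_set (A `+` B) -> finite_set (B `+` D) ->
  excess A D = excess A B + excess B D.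
Proof.
move=> fAB fBD; pose W := (A `+` B) `|` (B `+` D).
rewrite (@excess_window A D W).
  rewrite (@excess_window A B W)//; last by move=> ? ?; left.
  rewrite (@excess_window B D W)//; last by move=> ? ?; right.
  rewrite -fsbig_split; last by rewrite finite_setU.
  by apply: eq_fsbigr => v _ /=; rewrite /indicator_diff addrA subrK.
move=> v; rewrite /W /setY /=; move: (EM (A v)) (EM (B v)) (EM (D v)); tauto.
Qed.

Lemma excess_image s A B : excess (s @` A) (s @` B) = excess A B.
Proof.
have sinj := can_inj (@sym_funK s).
have sE D v : `[< (s @` D) (s v) >] = `[< D v >].
  by apply/asbool_equiv_eq; split=> [[u Du /sinj <-]|Dv] //; exists v.
rewrite /excess (@reindex_fsbigT _ _ _ _ _ s); last first.
  by exists (sym_inv s); [exact: sym_funK|exact: sym_invK].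
by apply: eq_fsbigr => v _; rewrite /indicator_diff !sE.
Qed.

Definition sym_index s : int := excess (s @` natZ) natZ.

Lemma sym_index1 : sym_index 1%g = 0.
Proof.
rewrite /sym_index /excess fsbig1// => v _.
by rewrite (image_id natZ : (1%g : symZN) @` natZ = natZ) /indicator_diff subrr.
Qed.

(** Additivity holds because excess is a cocycle invariant under Sym(Z, N). *)
Lemma sym_indexM s s' : sym_index (s * s')%g = sym_index s + sym_index s'.
Proof.
rewrite /sym_index sym_imageM (@excess_add _ (s @` natZ)) ?excess_image 1?addrC//.
  apply: finite_setY_image; first exact: can_inj (@sym_funK s).
  exact: sym_comm.
exact: sym_comm.
Qed.

Lemma sym_indexV s : sym_index s^-1%g = - sym_index s.
Proof. by apply/eqP; rewrite -addr_eq0 -sym_indexM mulVg sym_index1. Qed.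

Lemma sym_indexR s s' : sym_index [~ s, s']%g = 0.
Proof. by rewrite /commg /conjg !sym_indexM !sym_indexV; lia. Qed.

(** All crossings of 0 land in the window from -m to m - 1. Being of index zero then
    means that as many positions of the window are images of nonnegative integers as
    are nonnegative, so a permutation of the window matches the two sets. The window
    is shifted by m to be indexed from 0. *)
Lemma ex_matching s (m : nat) :
  (forall v, (s @` natZ `+` natZ) v -> - m%:Z <= v < m%:Z) -> sym_index s = 0 ->
  exists p : {perm 'I_(m + m)},
    forall i : 'I_(m + m), (s @` natZ) (i%:Z - m%:Z) <-> (m <= p i)%N.
Proof.
move=> win s0; pose pos (i : 'I_(m + m)) : int := i%:Z - m%:Z.
pose r := map pos (enum 'I_(m + m)).
have posinj : injective pos by move=> i j; rewrite /pos => e; apply/val_inj => /=; lia.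
pose a := [tuple `[< (s @` natZ) (pos i) >] | i < m + m].
pose b := [tuple (m <= i)%N | i < m + m].
have cnt : count id a = count id b.
  have : \sum_(i < m + m) indicator_diff (s @` natZ) natZ (pos i) = 0.
    have ur : uniq r by rewrite map_inj_uniq ?enum_uniq.
    rewrite -big_enum -(big_map pos predT (indicator_diff (s @` natZ) natZ)).
    rewrite (fsbig_seq _ _ ur) -excess_window// => v /win vm; apply/mapP.
    have vm' : (absz (v + m%:Z)%R < m + m)%N by lia.
    by exists (Ordinal vm'); rewrite ?mem_enum// /pos /=; lia.
  move=> sum0; have e : (\sum_(i < m + m) (`[< (s @` natZ) (pos i) >] : nat) =
      \sum_(i < m + m) ((m <= i)%N : nat))%N.
    apply/eqP; rewrite -eqz_nat !(big_morph Posz PoszD (erefl 0%:Z)).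
    rewrite -subr_eq0 -sumrB -[X in _ == X]sum0; apply/eqP; apply: eq_bigr => i _.
    rewrite /indicator_diff; congr (_ - (nat_of_bool _)%:Z).
    by apply/idP/asboolP; rewrite /natZ /= /pos; lia.
  have cntE (f : 'I_(m + m) -> bool) :
      count id [tuple f i | i < m + m] = (\sum_(i < m + m) (f i : nat))%N.
    by rewrite /= count_map -sumn_count sumnE big_map big_enum.
  by rewrite !cntE.
have [p pE] : exists p : {perm 'I_(m + m)}, a = [tuple tnth b (p i) | i < m + m].
  have /tuple_permP[p pE] : perm_eq a b.
    have cF (x : seq bool) : count_mem false x = (size x - count id x)%N.
      by rewrite -(count_predC id x) addKn; apply: eq_count => -[].
    have cT (x : seq bool) : count_mem true x = count id x.
      by apply: eq_count => -[].
    have cE x : count_mem x a = count_mem x b.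
      by case: x; rewrite ?cT ?cF ?size_tuple cnt.
    by apply/allP => x _; apply/eqP; exact: cE.
  by exists p; apply: val_inj.
exists p => i; have := congr1 (fun x => tnth x i) pE; rewrite !tnth_mktuple => <-.
by split=> [?|/asboolP//]; exact/asboolP.
Qed.

End index.

Section index_zero.
Context (R : realType) d (X : measurableType d) (mu : probability X R).
Variable T : aut mu.
Hypothesis X_sep : countably_separated X.
Hypotheses (mu_atomless : atomless mu) (T_ergodic : ergodic T).
Local Notation t := (aut_iter T).

Let T_free := aperiodic X_sep mu_atomless T_ergodic.

Variables (N H : set (aut mu)) (C : set (aut_com T)).
Hypotheses (N_sub : is_subgroup N) (cC : closed C)
  (NE : N = com_full_group T `&` C)
  (N_norm : forall x y, N x -> H y -> N (x ^ y)%g)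
  (DH : derived_subgroup (com_full_group T) `<=` H)
  (N_nontrivial : exists2 g, N g & g <> 1%g).

Lemma tower_perm_in_normal (I : finType) (P : tower T I) (s : {perm I}) :
  N (tower_perm P s).
Proof.
apply: (periodic_in_normal X_sep mu_atomless T_ergodic N_sub cC NE N_norm DH N_nontrivial).
  exact: tower_perm_com.
apply: filterS (ae_iter T (tower_permE P s)) => x E; exists #[s^-1]%g.-1.
have iterE n : iter n (aut_map (tower_perm P s)) x = tower_fun P (s^-1 ^+ n)%g x.
  elim: n => [|n IH]; first by rewrite expg0 tower_fun1.
  by rewrite iterS IH {1}/tower_fun E expgSr -tower_fun_comp.
by rewrite iterE prednK ?order_gt0// expg_order tower_fun1.
Qed.

(** The orbit of 0 stays in a finite interval, so it repeats. *)
Lemma iter_return (u : int -> int) (a b : int) : injective u -> a <= 0 < b ->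
  (forall n, a <= n < b -> a <= u n < b) -> exists l : nat, iter l.+1 u 0 = 0.
Proof.
move=> uinj ab uab.
have itab n : a <= iter n u 0 < b by elim: n => //= n; exact: uab.
pose L := absz (b - a).
have ltL n : (absz (iter n u 0 - a)%R < L)%N by have := itab n; rewrite /L; lia.
pose f (j : 'I_L.+1) : 'I_L := Ordinal (ltL j).
have /injectivePn[i [j ij fij]] : ~~ injectiveb f.
  by apply/negP => /injectiveP/leq_card; rewrite !card_ord ltnn.
have {}fij : iter i u 0 = iter j u 0.
  have := congr1 val fij; rewrite /=; have := itab i; have := itab j; lia.
have iinj k : injective (iter k u) by elim: k => // k IH v v' /= /uinj /IH.
have back (k l : nat) : (k < l)%N -> iter k u 0 = iter l u 0 ->
    exists q : nat, iter q.+1 u 0 = 0.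
  move=> kl; rewrite -(subnKC (ltnW kl)) iterD => /iinj /esym e.
  by exists (l - k).-1; rewrite prednK ?subn_gt0.
have [lij|lji|/val_inj e] := ltngtP i j; last by rewrite e eqxx in ij.
  exact: back lij fij.
exact: back lji (esym fij).
Qed.

(** At the points of A, all crossings made by w land in a window of radius m,
    according to a fixed pattern; p rearranges each window so
    that every point is brought back to the side it came from. The return times to A
    are larger than 2 m, so the windows are disjoint and p makes no crossing at the
    other points of A. *)
Lemma ex_preserved_cut (w : aut mu) : com_full_group T w ->
  {ae mu, forall x, exists s : symZN, acts_as T w x s /\ sym_index s = 0} ->
  exists A (p : aut mu), [/\ measurable A, (0 < mu A)%E, N p &
    {ae mu, forall x, forall u : int -> int, acts_as T (p * w)%g x u ->
      forall k, A (t k x) -> forall n, k <= n <-> k <= u n}].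
Proof.
move=> Gw w0; have [Tw _] := Gw; pose c := cocycle T w.
pose sg x (n : int) : int := n + c (t n x).
have msg n (Q : int -> Prop) : measurable [set x | Q (sg x n)].
  have mQ : measurable [set x | Q (n + c x)].
    rewrite (_ : [set x | _] = c @^-1` [set k | Q (n + k)])//.
    by rewrite -[X in measurable X]setTI; exact: measurable_cocycle.
  exact: measurable_preimage_iter mQ.
have aS := acts_as_cocycle X_sep Tw.
have good : {ae mu, forall x, (forall k l, t k x = t l x -> k = l) /\
    exists s : symZN, [/\ acts_as T w x s, sym_index s = 0 & forall n, sg x n = s n]}.
  apply: filterS3 w0 T_free aS => x [s [ws s0]] free cx; split => //.
  exists s; split => // n; exact: acts_as_unique free cx ws n.
(* m exists because only finitely many integers cross 0; there are finitely many
   possible sets Rm of window positions that receive a nonnegative integer *)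
pose window (m : nat) x := forall n : int,
  ~ (natZ n <-> natZ (sg x n)) -> - m%:Z <= sg x n < m%:Z.
have mwindow m : measurable [set x | window m x].
  apply: measurable_forallc => n.
  exact: (msg n (fun k => ~ (natZ n <-> natZ k) -> - m%:Z <= k < m%:Z)).
have muT : (0 < mu [set: X])%E by rewrite probability_setT lte01.
have [m Wm0] : exists m : nat, (0 < mu ([set: X] `&` [set x | window m x]))%E.
  apply: (pos_ae_split measurableT muT mwindow).
  apply: filterS good => x [_ [s [_ _ sE]]] _.
  have [|m mP] := @commN_window [set s @` natZ] (finite_set1 _).
    by move=> _ ->; exact: sym_comm.
  exists m.+1 => n; rewrite sE => nn.
  suff : ~ (m < absz (s n))%N by lia.
  move=> ms; have sN := mP _ erefl _ ms; apply: nn; rewrite -sN; split=> [nN|]; first by exists n.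
  by move=> [k kN /(can_inj (@sym_funK s)) <-].
have mWm := measurableI _ _ measurableT (mwindow m).
pose pattern (Rm : {ffun 'I_(m + m) -> bool}) x := forall i : 'I_(m + m),
  Rm i <-> exists n : int, natZ n /\ sg x n = i%:Z - m%:Z.
have mpattern Rm : measurable [set x | pattern Rm x].
  apply: measurable_forallc => i; apply: measurable_ifP; first exact: measurable_cstP.
  apply: measurable_existsc => n; apply: measurable_andP; first exact: measurable_cstP.
  exact: (msg n (fun k => k = i%:Z - m%:Z)).
have [Rm WR0] : exists Rm : {ffun 'I_(m + m) -> bool},
    (0 < mu ([set: X] `&` [set x | window m x] `&` [set x | pattern Rm x]))%E.
  apply: (pos_ae_split mWm Wm0 mpattern).
  apply: aeW => x _; exists [ffun i : 'I_(m + m) =>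
    `[< exists n : int, natZ n /\ sg x n = i%:Z - m%:Z >]].
  by move=> i; rewrite ffunE; split=> /asboolP.
have mWR := measurableI _ _ mWm (mpattern Rm).
have kinj : injective (fun i : 'I_(m + m).+1 => (i : nat)%:Z).
  by move=> i j [] /val_inj.
have [A [mA AW A0 dA]] := ex_tower X_sep mu_atomless T_ergodic kinj mWR WR0.
have far a k : A a -> A (t k a) -> k <> 0 -> k < - (m + m)%:Z \/ (m + m)%:Z < k.
  have main b (n : nat) : A b -> A (t n%:Z b) -> (n <= m + m)%N -> n = 0%N.
    rewrite -ltnS => Ab Atb nm.
    by have /(congr1 val) := dA (Ordinal nm) ord0 b (t n%:Z b) Ab Atb erefl.
  move=> Aa Atk k0; apply: contrapT => /not_orP[k1 k2].
  have [kp|kn] := leP 0 k.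
    have Ab : A (t (absz k)%:Z a) by rewrite gez0_abs.
    by have := main _ _ Aa Ab; lia.
  have Ab : A (t (absz k)%:Z (t k a)) by rewrite -aut_iterD ltz0_abs// addNr.
  by have := main _ _ Atk Ab; lia.
have dwin : disjoint_translates T (fun i : 'I_(m + m) => i%:Z - m%:Z) A.
  move=> i j a b Aa Ab /aut_iter_eq ba; apply/val_inj => /=; apply: contrapT => ij.
  have := @far a _ Aa; rewrite ba in Ab; move=> /(_ _ Ab).
  by have := ltn_ord i; have := ltn_ord j; lia.
pose P := Tower mA dwin.
have [a0 [Aa0 [free0 [s0 [ws0 s00 sE0]]]]] := pos_ae_pick mA A0 good.
have Rs0 (i : 'I_(m + m)) : Rm i <-> (s0 @` natZ) (i%:Z - m%:Z).
  have [_ /(_ i) ->] := AW _ Aa0; split=> [[n [Nn <-]]|[n Nn nE]].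
    by exists n => //; rewrite sE0.
  by exists n; split => //; rewrite sE0.
have [|q qP] := @ex_matching s0 m _ s00.
  have [[_ win0] _] := AW _ Aa0; move=> v cross.
  pose n := sym_inv s0 v; have nv : sg a0 n = v by rewrite sE0 sym_invK.
  rewrite -nv; apply: win0; rewrite nv => nn; case: cross => -[].
    by move=> [k Nk kv] Nv; apply: Nv; apply/nn; rewrite /n -kv sym_funK.
  by move=> Nv sv; apply: sv; exists n; [exact/nn|rewrite /n sym_invK].
have Rq (i : 'I_(m + m)) : Rm i <-> (m <= q i)%N by rewrite Rs0.
exists A, (tower_perm P q^-1%g); split => //; first exact: tower_perm_in_normal.
have E1 := ae_iter T (tower_permE P q^-1%g).
have E2 := ae_iter T (aut_mulE (tower_perm P q^-1%g) w).
apply: filterS3 good E1 E2 => x [free [s [ws _ sE]]] pE vE u vu k Ak n.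
pose a := t k x; pose n' := n - k; pose y := s n - k.
have sga j : sg a (j - k) = s j - k.
  by rewrite /sg /a -aut_iterD subrK -sE /sg addrAC.
have vn : t (u n) x = tower_fun P q (t y a).
  rewrite -vu vE ws pE invgK; congr (tower_fun _ _ _).
  by rewrite /a -aut_iterD subrK.
suff [z zE zn] : exists2 z, tower_fun P q (t y a) = t z a & (0 <= z) = (0 <= n').
  move: vn; rewrite zE /a -aut_iterD => /free uz.
  by split=> h; move: zn; rewrite /n'; lia.
have [[_ wina] pata] := AW _ Ak.
have [yw|yw] := boolP (- m%:Z <= y < m%:Z).
  have im : (absz (y + m%:Z)%R < m + m)%N by lia.
  pose i := Ordinal im; have iy : theight P i = y by rewrite /=; lia.
  exists (theight P (q i)); first by rewrite -iy tower_fun_level.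
  have RiN : Rm i <-> 0 <= n'.
    rewrite (pata i) (_ : i%:Z - m%:Z = y); last by rewrite -iy.
    split=> [[j [Nj jy]]|Nn]; last by exists n'; rewrite /n' sga.
    have : sg a (j + k - k) = y by rewrite addrK.
    rewrite sga => /addIr /(can_inj (@sym_funK s)) jn.
    by move: Nj; rewrite /natZ /= /n'; lia.
  rewrite /=; apply/idP/idP => h.
    by apply/RiN/Rq; lia.
  by move/RiN/Rq: h; lia.
have yn : (0 <= y) = (0 <= n').
  have : natZ n' <-> natZ (sg a n').
    by apply: contrapT => /wina; rewrite /n' sga -/y (negPf yw).
  by rewrite /n' sga -/y /natZ /= => h; apply/idP/idP => /h.
have [[i /levelP[b Ab yE]]|nL] := pselect (exists i, level P i (t y a)); last first.
  by exists y => //; apply: tower_fun_off => i Li; apply: nL; exists i.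
have bE : b = t (y - theight P i) a by exact: aut_iter_eq yE.
exists (y - theight P i + theight P (q i)).
  by rewrite yE tower_fun_level// bE -aut_iterD addrC.
have j0 : y - theight P i <> 0.
  move=> e; move/negP: yw; apply; have := ltn_ord i; move: e => /=; lia.
have Atb : A (t (y - theight P i) a) by rewrite -bE.
have := far a _ Ak Atb j0; rewrite -yn /=.
by have := ltn_ord i; have := ltn_ord (q i); lia.
Qed.

(** Once p w preserves every half-orbit starting at a point of A, it preserves the
    finite intervals between consecutive visits to A, hence is periodic. *)
Lemma index_zero_in_normal (w : aut mu) : com_full_group T w ->
  {ae mu, forall x, exists s : symZN, acts_as T w x s /\ sym_index s = 0} -> N w.
Proof.
move=> Gw w0; have [A [p [mA A0 Np cut]]] := ex_preserved_cut Gw w0.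
have Gp : com_full_group T p by move: Np; rewrite NE => -[].
have Gpw : com_full_group T (p * w)%g.
  exact: (subgroupM (com_full_group_subgroup X_sep T_free)).
suff Npw : N (p * w)%g.
  by rewrite -[w](mulKg p); apply: (subgroupM N_sub) => //; exact: (subgroupV N_sub).
apply: (periodic_in_normal X_sep mu_atomless T_ergodic N_sub cC NE N_norm DH
  N_nontrivial Gpw).
have up := recurrence mu_atomless T_ergodic true 0 mA A0.
have down := recurrence mu_atomless T_ergodic false (-1) mA A0.
move/(com_full_groupP X_sep T_free) in Gpw.
apply: filterS3 (ae_andP up down) Gpw cut => x [[b [b0 Ab]] [a [a0 Aa]]] [u vu] cutx.
have [l lP] : exists l : nat, iter l.+1 u 0 = 0.
  apply: (@iter_return u a b); [exact: can_inj (@sym_funK u)|lia|move=> n nab].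
  by have := cutx u vu _ Ab n; have := cutx u vu _ Aa n; lia.
exists l; have iterE n : iter n (aut_map (p * w)%g) x = t (iter n u 0) x.
  by elim: n => //= n ->; rewrite vu.
by rewrite iterE lP.
Qed.

Lemma derived_sub_normal : derived_subgroup (com_full_group T) `<=` N.
Proof.
apply: smallest_sub => // _ [f Gf [g Gg <-]].
have Gsub := com_full_group_subgroup X_sep T_free.
have GR : com_full_group T [~ f, g]%g.
  rewrite /commg /conjg; do ![apply: (subgroupM Gsub) => //|apply: (subgroupV Gsub) => //].
apply: index_zero_in_normal GR _.
move/(com_full_groupP X_sep T_free) in Gf; move/(com_full_groupP X_sep T_free) in Gg.
have E1 := ae_andP (ae_iter T (aut_invE f)) (ae_iter T (aut_invE g)).
have E2 := ae_andP (ae_iter T (aut_mulE f^-1%g (g^-1 * (f * g))%g))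
  (ae_andP (ae_iter T (aut_mulE g^-1%g (f * g)%g)) (ae_iter T (aut_mulE f g))).
have E := ae_andP E1 E2.
apply: filterS3 Gf Gg E => x [s fs] [s' gs'] [[fV gV] [M1 [M2 M3]]].
exists [~ s, s']%g; split; last exact: sym_indexR.
exact: acts_as_mul M1 (acts_as_inv fV fs) (acts_as_mul M2 (acts_as_inv gV gs')
  (acts_as_mul M3 fs gs')).
Qed.

End index_zero.

Theorem theorem4 (R : realType) (d : measure_display) (X : measurableType d)
    (mu : probability X R) (X_standard : standard_borel R X)
    (mu_atomless : atomless mu) (T : aut mu) (T_ergodic : ergodic T) :
  topologically_simple (com_top_derived T).
Proof.
move=> N [N_sub NH N_norm] [C cC NE].
have [N1|N1] := pselect (N = [set 1%g]); first by left.
right; have X_sep := standard_countably_separated X_standard.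
pose D : set (aut_com T) := derived_subgroup (com_full_group T).
have T_free := aperiodic X_sep mu_atomless T_ergodic.
have DG : D `<=` com_full_group T.
  apply: smallest_sub; first exact: com_full_group_subgroup.
  move=> _ [f Gf [g Gg <-]]; have Gsub := com_full_group_subgroup X_sep T_free.
  by rewrite /commg /conjg; do ![apply: (subgroupM Gsub) => //|apply: (subgroupV Gsub) => //].
have DN : D `<=` N.
  apply: (@derived_sub_normal R d X mu T X_sep mu_atomless T_ergodic N
    (com_top_derived T) (closure D `&` C)) => //.
  - by apply: closedI => //; exact: closed_closure.
  - by rewrite NE /com_top_derived setIA.
  - by move=> x Dx; split; [exact: DG|exact: subset_closure].
  - apply: contrapT => nN; apply: N1; apply/seteqP; split => x; last first.
      by move=> ->; case: N_sub.
    by move=> Nx; apply: contrapT => x1; apply: nN; exists x.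
apply/seteqP; split=> // x [Gx Dx]; rewrite NE; split; first by split.
by apply: cC; apply: closure_subset Dx => y /DN; rewrite NE => -[].
Qed.
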